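(* Let $K_0:=\,]-\infty,0]\times\{0\}\subset\mathbb{R}^2$ and let $\varphi_0:\mathbb{R}^2\setminus K_0\to\mathbb{R}$ be given in polar coordinates by $$\varphi_0(r,\theta):=\sqrt{\frac{2r}{\pi}}\,\sin(\theta/2),\qquad r>0,\ \theta\in\,]-\pi,\pi[.$$ Then the couple $(\varphi_0,K_0)$ (the cracktip) is stationary in $\mathbb{R}^2$, i.e. for all $\eta\in C^1_c(\mathbb{R}^2)^2$, $$\int_{\mathbb{R}^2\setminus K_0}\Big(|\nabla\varphi_0|^2\,\mathrm{div}\,\eta-2\langle\nabla\varphi_0,\nabla\varphi_0\cdot\nabla\eta\rangle\Big)\,dx+\int_{K_0}\mathrm{div}^{K_0}\eta\,d\mathcal{H}^1=0.$$
   Context: Polar coordinates: $(x,y)=(r\cos\theta,r\sin\theta)$. Here $\langle\nabla\varphi_0,\nabla\varphi_0\cdot\nabla\eta\rangle=\sum_{i,j}\partial_i\varphi_0\,\partial_j\varphi_0\,\partial_j\eta^i$, and $\mathrm{div}^{K_0}\eta$ is the tangential divergence along $K_0$, which for this $K_0$ is $\partial_1\eta^1$. $\mathcal{H}^1$ is the one-dimensional Hausdorff measure. *)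

(* Defs.v *)
From HB Require Import structures.
From mathcomp Require Import all_boot all_order all_algebra.
From mathcomp Require Import all_classical all_reals all_analysis.

Set Implicit Arguments.
Unset Strict Implicit.
Unset Printing Implicit Defensive.

Import Order.TTheory GRing.Theory Num.Theory.
Import numFieldNormedType.Exports.

Local Open Scope classical_set_scope.
Local Open Scope ring_scope.

Definition coord (R : realType) (i : 'I_2) (p : R * R) : R :=
  if i == ord0 then p.1 else p.2.

Definition basis_vec (R : realType) (i : 'I_2) : R * R :=
  if i == ord0 then (1, 0) else (0, 1).
Arguments basis_vec : clear implicits.

Definition partial (R : realType) (i : 'I_2) (f : R * R -> R) (p : R * R) : R :=
  'D_(basis_vec R i) f p.

Definition C1c (R : realType) (f : R * R -> R) : Prop :=
  [/\ forall i p, derivable f p (basis_vec R i),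
      forall i, continuous (partial i f)
    & compact (closure [set p | f p != 0])].

Definition C1c_field (R : realType) (eta : R * R -> R * R) : Prop :=
  forall i, C1c (fun p => coord i (eta p)).

Definition grad_sqnorm (R : realType) (f : R * R -> R) (p : R * R) : R :=
  \sum_(i < 2) partial i f p ^+ 2.

Definition div (R : realType) (eta : R * R -> R * R) (p : R * R) : R :=
  \sum_(i < 2) partial i (fun q => coord i (eta q)) p.

(* <grad f, grad f . grad eta> *)
Definition grad_form (R : realType) (f : R * R -> R) (eta : R * R -> R * R)
    (p : R * R) : R :=
  \sum_(i < 2) \sum_(j < 2)
    partial i f p * partial j f p * partial j (fun q => coord i (eta q)) p.

(* Tangential divergence at p along a curve with unit tangent vector tau
   at p. *)
Definition tangential_div (R : realType) (tau : R * R)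
    (eta : R * R -> R * R) (p : R * R) : R :=
  \sum_(i < 2) \sum_(j < 2)
    coord i tau * coord j tau * partial j (fun q => coord i (eta q)) p.

(* The norm of the product R * R is the sup norm, so the Euclidean distance
   has to be given explicitly. *)
Definition euclid_dist (R : realType) (p q : R * R) : R :=
  Num.sqrt ((p.1 - q.1) ^+ 2 + (p.2 - q.2) ^+ 2).

(* 0 is added so that the diameter of the empty set is 0 and not -oo. *)
Definition diam (R : realType) (A : set (R * R)) : \bar R :=
  ereal_sup (0%E |` [set (euclid_dist p q)%:E | p in A & q in A]).

Definition hausdorff1_delta (R : realType) (delta : R) (A : set (R * R)) :
    \bar R :=
  ereal_inf [set (\sum_(0 <= k <oo) diam (C k))%E
    | C in [set C : (set (R * R))^nat |
        A `<=` \bigcup_k C k /\ forall k, (diam (C k) <= delta%:E)%E]].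

(* One-dimensional Hausdorff (outer) measure; the normalising constant is 1 in
   dimension one. An integral against it only evaluates it on Borel sets. *)
Definition hausdorff1 (R : realType) (A : set (R * R)) : \bar R :=
  ereal_sup [set hausdorff1_delta delta A | delta in [set d : R | 0 < d]].

Definition halfline (R : realType) : set (R * R) :=
  `]-oo, 0%R]%classic `*` [set 0%R].
Arguments halfline : clear implicits.

(* phi is total, but only its values off the half-line are prescribed: every
   point of the complement of the half-line has exactly one pair of polar
   coordinates in the given range. *)
Definition is_cracktip_function (R : realType) (phi : R * R -> R) : Prop :=
  forall r theta : R, 0 < r -> - pi < theta < pi ->
    phi (r * cos theta, r * sin theta)
    = Num.sqrt (2 * r / pi) * sin (theta / 2).

(* Stationarity in the plane of a pair (phi, K), where tau p is a unit tangent
   vector to K at p. Both integrals are extended-real valued and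
   +oo + -oo = -oo, so the equation forces each of them to be finite. *)
Definition stationary (R : realType) (phi : R * R -> R) (K : set (R * R))
    (tau : R * R -> R * R) : Prop :=
  forall eta : R * R -> R * R, C1c_field eta ->
    (\int[@lebesgue_measure R \x @lebesgue_measure R]_(p in ~` K)
        (grad_sqnorm phi p * div eta p - 2 * grad_form phi eta p)%:E
     + \int[@hausdorff1 R]_(p in K) (tangential_div (tau p) eta p)%:E = 0)%E.

(* Main.v *)
Require Import Defs.
From HB Require Import structures.
From mathcomp Require Import all_boot all_order all_algebra.
From mathcomp Require Import all_classical all_reals all_analysis.
From mathcomp Require Import measurable_realfun.
From mathcomp Require Import ring lra.
Import Order.TTheory GRing.Theory Num.Theory.
Import numFieldNormedType.Exports.
Local Open Scope classical_set_scope.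
Local Open Scope ring_scope.

Set Implicit Arguments.
Unset Strict Implicit.
Unset Printing Implicit Defensive.

(**
Off the half-line the cracktip function is [y / sqrt (pi (r + x))].  Hence, for
eta = (f, g), the bulk integrand equals [W / (2 pi)] with
[W = (x f_x + y f_y + y g_x - x g_y) / (x^2 + y^2)], that is, grad (ln r) paired
with grad f plus the rotated field paired with grad g.  Both fields are
divergence free away from the origin.  Replacing x by x + c in them, with c > 0 on
the right half-plane and c < 0 on the left one, removes the singularity, and the
divergence theorem turns the two bulk integrals into integrals over the y-axis.
There the contributions of g cancel, while those of f add up to minus the integral
of [2 |c| f (0, y) / (c^2 + y^2)], which tends to [- 2 pi f (0, 0)] as c tends to 0
(Poisson kernel).  Dominated convergence applies because
[|W| <= K / sqrt (|x| |y|)], so the bulk term is [- f (0, 0)].  On the half-line the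
Hausdorff measure is the Lebesgue measure, so the surface term is the integral of
[f_x (x, 0)] over x <= 0, which is [f (0, 0)].
*)

Local Notation leb2 R := (@lebesgue_measure R \x @lebesgue_measure R)%E.
Local Notation plane R := (measurableTypeR R * measurableTypeR R)%type.

(** * Functions on the plane *)

(** Measurability in the plane refers to the product sigma-algebra. In the sup norm a ball is a
    product of two intervals, so an open set is a countable union of measurable squares with
    rational centre and radius. *)
Lemma open_measurable_plane {R : realType} (A : set (R * R)) : open A -> measurable A.
Proof.
move=> oA.
pose B (q : rat * rat * rat) : set (R * R) :=
  if `[< ball (ratr q.1.1 : R, ratr q.1.2 : R) (ratr q.2 : R) `<=` A >] then
   ball (ratr q.1.1 : R) (ratr q.2 : R) `*` ball (ratr q.1.2 : R) (ratr q.2 : R) else set0.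
have -> : A = \bigcup_q B q.
  apply/seteqP; split => [[x y] Axy|[x y] [q _]]; last first.
    by rewrite /B; case: ifPn => // /asboolP + qxy; apply.
  have /nbhs_ballP[e /= e0 eA] : nbhs (x, y) A by apply: open_nbhs_nbhs.
  (* With radius [d < e / 2] and a centre closer than [d] to [(x, y)], the rational square contains
     [(x, y)] and stays within [2 d < e] of it. *)
  have [d] := @rat_in_itvoo R 0 (e / 2) ltac:(lra).
  rewrite in_itv/= => /andP[d0 de].
  have [a] := @rat_in_itvoo R (x - ratr d) (x + ratr d) ltac:(lra).
  have [b] := @rat_in_itvoo R (y - ratr d) (y + ratr d) ltac:(lra).
  rewrite !in_itv/= => /andP[yb1 yb2] /andP[xa1 xa2].
  exists (a, b, d) => //; rewrite /B /=.
  case: ifPn => [_|/asboolPn].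
    split; rewrite /ball/= ltr_norml; lra.
  move=> H; exfalso; apply: H => -[u v] [/= ua vb]; apply: eA.
  move: ua vb; rewrite /ball/= !ltr_norml => /andP[? ?] /andP[? ?].
  split; rewrite /ball/= ltr_norml; lra.
apply: countable_bigcupT_measurable; first exact: countableP.
move=> q.
rewrite /B; case: ifPn => // _.
by apply: measurableX; apply: open_measurable; exact: ball_open.
Qed.

(** Continuity is meant in the whole plane, not relative to [D]: every point of [D] in the preimage
    of an open interval is interior to that preimage, so the interior may replace it. *)
Lemma measurable_fun_continuous_at {R : realType} (D : set (R * R)) (g : R * R -> R) :
  measurable D -> (forall p, D p -> {for p, continuous g}) -> measurable_fun D g.
Proof.
move=> mD cg; apply: (measurability _ (RGenOpens.measurableE R)).
move=> _ [_ [a [b ->] <-]].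
rewrite (_ : D `&` _ = D `&` (g @^-1` `]a, b[%classic)^°).
  by apply: measurableI => //; apply: open_measurable_plane; exact: open_interior.
apply/seteqP; split => p [Dp gp]; split => //; last exact: interior_subset gp.
apply: (cg p Dp); apply: open_nbhs_nbhs; split => //; exact: interval_open.
Qed.

(** Both sides have the same difference quotient. This reduces partial derivatives to one-variable
    calculus. *)
Lemma is_derive_horizontal {R : realType} (f : R * R -> R) (p : R * R) (l : R) :
  is_derive p ((1, 0) : R * R) f l <-> is_derive p.1 (1 : R) (fun s => f (s, p.2)) l.
Proof.
have E : (fun h : R => f (h *: ((1, 0) : R * R) + p)) = (fun h : R => f ((h *: (1:R) + p.1,
  p.2))).
  apply/funext => h; case: p => x y; rewrite /= -[h *: _ + _]/(h * _ + x, h * _ + y) /=.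
  by rewrite /GRing.scale/= mulr0 add0r.
pose G (w : R -> R) (h : R) : R := h^-1 *: (w h - f p).
have D : derivable f p ((1, 0) : R * R) = derivable (fun s => f (s, p.2)) p.1 (1 : R).
  rewrite -[LHS]/(cvg (G (fun h : R => f (h *: ((1, 0) : R * R) + p)) @ 0^')) E.
  by rewrite /G; case: p {E G}.
have D' : 'D_((1, 0) : R * R) f p = 'D_(1 : R) (fun s => f (s, p.2)) p.1.
  rewrite -[LHS]/(lim (G (fun h : R => f (h *: ((1, 0) : R * R) + p)) @ 0^')) E.
  by rewrite /G; case: p {E G D}.
split=> -[d dE]; split.
- exact: (eq_ind _ id d _ D).
- exact: (etrans (esym D') dE).
- exact: (eq_ind _ id d _ (esym D)).
- exact: (etrans D' dE).
Qed.

Lemma is_derive_vertical {R : realType} (f : R * R -> R) (p : R * R) (l : R) :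
  is_derive p ((0, 1) : R * R) f l <-> is_derive p.2 (1 : R) (fun s => f (p.1, s)) l.
Proof.
have E : (fun h : R => f (h *: ((0, 1) : R * R) + p)) = (fun h : R => f ((p.1, h *: (1:R) +
  p.2))).
  apply/funext => h; case: p => x y; rewrite /= -[h *: _ + _]/(h * _ + x, h * _ + y) /=.
  by rewrite /GRing.scale/= mulr0 add0r.
pose G (w : R -> R) (h : R) : R := h^-1 *: (w h - f p).
have D : derivable f p ((0, 1) : R * R) = derivable (fun s => f (p.1, s)) p.2 (1 : R).
  rewrite -[LHS]/(cvg (G (fun h : R => f (h *: ((0, 1) : R * R) + p)) @ 0^')) E.
  by rewrite /G; case: p {E G}.
have D' : 'D_((0, 1) : R * R) f p = 'D_(1 : R) (fun s => f (p.1, s)) p.2.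
  rewrite -[LHS]/(lim (G (fun h : R => f (h *: ((0, 1) : R * R) + p)) @ 0^')) E.
  by rewrite /G; case: p {E G D}.
split=> -[d dE]; split.
- exact: (eq_ind _ id d _ D).
- exact: (etrans (esym D') dE).
- exact: (eq_ind _ id d _ (esym D)).
- exact: (etrans D' dE).
Qed.

(** The working form of a compactly supported C^1 function: the partial derivatives are named,
    bounded by one constant, and everything vanishes from the boundary of the square of half-side
    [M] outwards, edges included. *)
Record C1_supported {R : realType} (M C : R) (f fx fy : R * R -> R) : Prop := {
  C1s_dx : forall p, is_derive p.1 (1 : R) (fun s => f (s, p.2)) (fx p) ;
  C1s_dy : forall p, is_derive p.2 (1 : R) (fun s => f (p.1, s)) (fy p) ;
  C1s_cx : continuous fx ;
  C1s_cy : continuous fy ;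
  C1s_bx : forall p, `|fx p| <= C ;
  C1s_by : forall p, `|fy p| <= C ;
  C1s_out : forall p, M <= `|p.1| \/ M <= `|p.2| -> [/\ f p = 0, fx p = 0 & fy p = 0] }.

Lemma is_derive_continuous {R : realType} (f : R -> R) (x l : R) :
  is_derive x (1 : R) f l -> {for x, continuous f}.
Proof. by move=> [/derivable1_diffP/differentiable_continuous]. Qed.

Lemma lipschitz_derive {R : realType} (f df : R -> R) (C : R) :
  (forall x, is_derive x (1 : R) f (df x)) -> (forall x, `|df x| <= C) ->
  forall x y, `|f x - f y| <= C * `|x - y|.
Proof.
move=> fdf dfC x y; wlog yx : x y / y <= x.
  move=> H; have [yx|/ltW xy] := leP y x; first exact: H.
  by rewrite distrC (distrC x) H.
have [|c _ ->] := @MVT_segment R f df y x yx (fun z _ => fdf z).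
  by apply: continuous_subspaceT => z; exact: is_derive_continuous (fdf z).
by rewrite normrM ler_wpM2r.
Qed.

Lemma bounded_continuous_compact {R : realType} {T : topologicalType} (A : set T) (f : T -> R) :
  compact A -> {within A, continuous f} -> exists C, forall x, A x -> `|f x| <= C.
Proof.
move=> cA cf; have /compact_bounded[C [_ CP]] := continuous_compact cf cA.
by exists (C + 1) => x Ax; apply: (CP (C + 1)); [rewrite ltrDl|exists x].
Qed.

(** Only partial derivatives are given, so continuity needs an argument: joining two points by a
    horizontal and a vertical segment, the bounds on the derivatives give a Lipschitz estimate. *)
Lemma C1s_continuous {R : realType} (M C : R) (f fx fy : R * R -> R) :
  C1_supported M C f fx fy -> continuous f.
Proof.
move=> H p.
have lip q : `|f p - f q| <= C * `|p.1 - q.1| + C * `|p.2 - q.2|.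
  case: p q => [x y] [u v] /=.
  rewrite (_ : f (x, y) - f (u, v) = (f (x, y) - f (u, y)) + (f (u, y) - f (u, v)));
    last by ring.
  rewrite (le_trans (ler_normD _ _))// lerD//.
    exact: (@lipschitz_derive R (fun s => f (s, y)) (fun s => fx (s, y)) C
      (fun s => C1s_dx H (s, y)) (fun s => C1s_bx H (s, y))).
  exact: (@lipschitz_derive R (fun s => f (u, s)) (fun s => fy (u, s)) C
      (fun s => C1s_dy H (u, s)) (fun s => C1s_by H (u, s))).
have C0 : 0 <= C by apply: le_trans (C1s_bx H p).
apply/cvgrPdist_le => e e0.
(* The denominator is [C + 1] because [C] may be 0. *)
have d0 : 0 < e / 2 / (C + 1) by rewrite !divr_gt0// ltr_wpDl.
have nb := nbhsx_ballx p _ d0.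
near=> q.
apply: le_trans (lip q) _.
have : ball p (e / 2 / (C + 1)) q by near: q.
case=> /ltW q1 /ltW q2.
have E : C * (e / 2 / (C + 1)) <= e / 2.
  rewrite mulrA ler_pdivrMr ?ltr_wpDl// mulrC ler_wpM2l//; lra.
have := ler_wpM2l C0 q1; have := ler_wpM2l C0 q2.
rewrite /=; lra.
Unshelve. all: by end_near. Qed.

Lemma C1s_weaken {R : realType} (M C M' C' : R) (f fx fy : R * R -> R) :
  M <= M' -> C <= C' -> C1_supported M C f fx fy -> C1_supported M' C' f fx fy.
Proof.
move=> MM CC [h1 h2 h3 h4 h5 h6 h7]; split => //.
- by move=> p; apply: le_trans (h5 p) CC.
- by move=> p; apply: le_trans (h6 p) CC.
- by move=> p [/(le_trans MM) ?|/(le_trans MM) ?]; apply: h7; [left|right].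
Qed.

(** Off the closed support the function is locally zero, so its partial derivatives vanish there as
    well; on the compact support they are bounded by continuity. *)
Lemma C1c_supported {R : realType} (f : R * R -> R) : C1c f ->
  exists M C, C1_supported M C f (partial ord0 f) (partial ord_max f).
Proof.
move=> [df cf cS].
set S := closure _ in cS.
have [M [_ MP]] := compact_bounded cS.
have out p : ~ S p -> f p = 0 /\ forall i, partial i f p = 0.
  move=> nSp; have Z : \forall q \near p, f q = cst 0 q.
    have oS : open (~` S) by apply: closed_openC; exact: closed_closure.
    near=> q; apply/eqP/negP => /negP fq.
    have : (~` S) q by near: q; apply: open_nbhs_nbhs.
    by apply; exact: subset_closure.
  split; first exact: (nbhs_singleton Z).
  by move=> i; rewrite /partial (near_eq_derive _ Z) derive_cst.
have bnd i : exists C, forall p, `|partial i f p| <= C.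
  have [C CP] := @bounded_continuous_compact R _ S (partial i f) cS (continuous_subspaceT (cf
    i)).
  exists (Num.max C 0) => p; have [Sp|nSp] := pselect (S p).
    by apply: le_trans (CP _ Sp) _; rewrite le_max lexx.
  by have [_ ->] := out p nSp; rewrite normr0 le_max lexx orbT.
have [C0 C0P] := bnd ord0; have [C1 C1P] := bnd ord_max.
(* Points of the support have norm at most any number above [M], in particular [M + 1 / 2], which is
   strictly below the chosen half-side. *)
exists (M + 1), (Num.max C0 C1); split => //.
- move=> p; apply/is_derive_horizontal; split; first exact: (df ord0 p).
  by [].
- move=> p; apply/is_derive_vertical; split; first exact: (df ord_max p).
  by [].
- by move=> p; apply: le_trans (C0P p) _; rewrite le_max lexx.
- by move=> p; apply: le_trans (C1P p) _; rewrite le_max lexx orbT.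
- move=> p pM; have [|f0 p0] := out p; last by split.
  move=> Sp; have : `|p| <= M + 1 / 2 by apply: (MP (M + 1 / 2)) => //; lra.
  by rewrite /Num.norm/= /Num.norm/= ge_max => /andP[p1 p2]; case: pM; lra.
Unshelve. all: by end_near. Qed.

(** * The divergence theorem on a rectangle *)

Section fubini_product.
Context {R : realType}.
Notation mu := (@lebesgue_measure R).
Local Open Scope ereal_scope.
Variables (A B : set R) (h : R * R -> \bar R).
Hypotheses (mA : measurable A) (mB : measurable B)
  (ih : (mu \x mu).-integrable (A `*` B) h).

Let mAB : @measurable _ (plane R) (A `*` B).
Proof. exact: measurableX. Qed.
Let ihT : (mu \x mu).-integrable setT (h \_ (A `*` B)).
Proof. exact: (proj1 (integrable_mkcond _ mAB) ih). Qed.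

Lemma integral_product_xy :
  \int[mu \x mu]_(p in A `*` B) h p = \int[mu]_(x in A) \int[mu]_(y in B) h (x, y).
Proof.
rewrite integral_mkcond -(integral12_prod_meas1 ihT) /fubini_F [RHS]integral_mkcond.
apply: eq_integral => x _; rewrite patchE; case: ifPn => xA.
  rewrite [RHS]integral_mkcond; apply: eq_integral => y _.
  by rewrite !patchE in_setX/= xA.
by apply: integral0_eq => y _; rewrite patchE in_setX/= (negbTE xA).
Qed.

Lemma integral_product_yx :
  \int[mu \x mu]_(p in A `*` B) h p = \int[mu]_(y in B) \int[mu]_(x in A) h (x, y).
Proof.
rewrite integral_mkcond -(integral21_prod_meas1 ihT) /fubini_G [RHS]integral_mkcond.
apply: eq_integral => y _; rewrite patchE; case: ifPn => yB.
  rewrite [RHS]integral_mkcond; apply: eq_integral => x _.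
  by rewrite !patchE in_setX/= yB andbT.
by apply: integral0_eq => x _; rewrite patchE in_setX/= (negbTE yB) andbF.
Qed.

End fubini_product.

Lemma continuous_plane_horizontal {R : realType} (g : R * R -> R) (p : R * R) :
  {for p, continuous g} -> {for p.1, continuous (fun s => g (s, p.2))}.
Proof.
case: p => x y cg; apply: (@continuous_comp _ _ _ (fun s : R => (s, y)) g) => //.
exact: (@cvg_pair _ _ _ (nbhs x) (nbhs x) (nbhs y) _ _ _ (fun s => s) (fun=> y) cvg_id (cvg_cst
  _)).
Qed.

Lemma continuous_plane_vertical {R : realType} (g : R * R -> R) (p : R * R) :
  {for p, continuous g} -> {for p.2, continuous (fun s => g (p.1, s))}.
Proof.
case: p => x y cg; apply: (@continuous_comp _ _ _ (fun s : R => (x, s)) g) => //.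
exact: (@cvg_pair _ _ _ (nbhs y) (nbhs x) (nbhs y) _ _ _ (fun=> x) (fun s => s) (cvg_cst _)
  cvg_id).
Qed.

Lemma integral_is_derive {R : realType} (F f : R -> R) (a b : R) : a < b ->
  {in `[a, b], forall x, is_derive x (1 : R) F (f x)} ->
  {in `[a, b], forall x, {for x, continuous f}} ->
  (\int[@lebesgue_measure R]_(x in `[a, b]) (f x)%:E = (F b - F a)%:E)%E.
Proof.
move=> ab dF cf; rewrite EFinB; apply: continuous_FTC2 => //.
- by apply: continuous_in_subspaceT => x; rewrite inE; exact: cf.
- split.
  + by move=> x /subset_itv_oo_cc xab; have [] := dF x xab.
  + apply: cvg_at_right_filter; apply: is_derive_continuous (dF a _).
    by rewrite in_itv/= lexx ltW.
  + apply: cvg_at_left_filter; apply: is_derive_continuous (dF b _).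
    by rewrite in_itv/= lexx ltW.
- by move=> x /subset_itv_oo_cc xab; rewrite derive1E; have [_ ->] := dF x xab.
Qed.

Lemma lebesgue_box_lty {R : realType} (a b c d : R) :
  ((leb2 R) (`[a, b] `*` `[c, d]) < +oo)%E.
Proof.
rewrite (_ : leb2 R _ = (lebesgue_measure (`[a, b]%classic : set R) *
  lebesgue_measure (`[c, d]%classic : set R))%E); last exact: product_measure1E.
rewrite !lebesgue_measure_itv/= !lte_fin.
by case: ifP => _; case: ifP => _; rewrite -?EFinB -?EFinM ?mule0 ?mul0e ltry.
Qed.

Lemma continuous_box_bounded {R : realType} (a b c d : R) (g : R * R -> R) :
  (forall p, (`[a, b] `*` `[c, d]) p -> {for p, continuous g}) ->
  exists C, forall p, (`[a, b] `*` `[c, d]) p -> `|g p| <= C.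
Proof.
move=> cg; apply: bounded_continuous_compact.
  by apply: compact_setX; exact: segment_compact.
by apply: continuous_in_subspaceT => p; rewrite inE; exact: cg.
Qed.

Lemma integrable_bounded_box {R : realType} (a b c d C : R) (D : set (R * R)) (g : R * R -> R) :
  D `<=` `[a, b] `*` `[c, d] -> measurable D -> measurable_fun D g ->
  (forall p, D p -> `|g p| <= C) ->
  (leb2 R).-integrable D (EFin \o g).
Proof.
move=> DB mD mg gC; apply: measurable_bounded_integrable => //.
  apply: le_lt_trans (lebesgue_box_lty a b c d).
  by apply: le_measure => //; rewrite inE//; exact: measurableX.
exists C; split; first exact: num_real.
by move=> x Cx p Dp; apply: le_trans (gC p Dp) (ltW Cx).
Qed.

Lemma integrable_continuous_box {R : realType} (a b c d : R) (g : R * R -> R) :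
  (forall p, (`[a, b] `*` `[c, d]) p -> {for p, continuous g}) ->
  (leb2 R).-integrable (`[a, b] `*` `[c, d]) (EFin \o g).
Proof.
move=> cg; have [C gC] := continuous_box_bounded cg.
apply: (@integrable_bounded_box _ a b c d C) => //; first exact: measurableX.
by apply: measurable_fun_continuous_at => //; exact: measurableX.
Qed.

(** Fubini is applied to each term in the order that integrates its own variable first, and the
    fundamental theorem of calculus evaluates the inner integral. *)
Lemma divergence_box {R : realType} (a b c d : R) (P Q Px Qy : R * R -> R) :
  a < b -> c < d ->
  (forall p, (`[a, b] `*` `[c, d]) p -> is_derive p.1 (1 : R) (fun s => P (s, p.2)) (Px p)) ->
  (forall p, (`[a, b] `*` `[c, d]) p -> is_derive p.2 (1 : R) (fun s => Q (p.1, s)) (Qy p)) ->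
  (forall p, (`[a, b] `*` `[c, d]) p -> {for p, continuous Px}) ->
  (forall p, (`[a, b] `*` `[c, d]) p -> {for p, continuous Qy}) ->
  (\int[leb2 R]_(p in `[a, b] `*` `[c, d]) (Px p + Qy p)%:E =
   \int[@lebesgue_measure R]_(y in `[c, d]) (P (b, y) - P (a, y))%:E +
   \int[@lebesgue_measure R]_(x in `[a, b]) (Q (x, d) - Q (x, c))%:E)%E.
Proof.
move=> ab cd dP dQ cP cQ.
have iP := integrable_continuous_box cP; have iQ := integrable_continuous_box cQ.
under eq_integral do rewrite EFinD.
rewrite integralD//; last exact: measurableX.
congr (_ + _)%E.
- rewrite integral_product_yx//=; apply: eq_integral => y; rewrite inE/= => ycd.
  apply: (@integral_is_derive R (fun x => P (x, y))) => // x xab.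
    exact: (dP (x, y)).
  by apply: (@continuous_plane_horizontal _ _ (x, y)); exact: cP.
- rewrite integral_product_xy//=; apply: eq_integral => x; rewrite inE/= => xab.
  apply: (@integral_is_derive R (fun y => Q (x, y))) => // y ycd.
    exact: (dQ (x, y)).
  by apply: (@continuous_plane_vertical _ _ (x, y)); exact: cQ.
Qed.

(** * The regularised bulk integrand *)

Lemma is_derive_div {R : realType} (n d : R -> R) (x n' d' : R) :
  is_derive x (1 : R) n n' -> is_derive x (1 : R) d d' -> d x != 0 ->
  is_derive x (1 : R) (fun s => n s / d s) ((n' * d x - n x * d') / d x ^+ 2).
Proof.
move=> dn dd dx0.
have dv := is_deriveV dx0 dd.
refine (@is_derive_eq _ _ _ _ _ _ _ _ (is_deriveM dn dv) _).
by rewrite /GRing.scale/=; field.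
Qed.

Lemma is_derive_sqr_shift {R : realType} (c k x : R) :
  is_derive x (1 : R) (fun s => (s + c) ^+ 2 + k) (2 * (x + c)).
Proof.
by apply: is_derive_eq; rewrite /GRing.scale/=; ring.
Qed.

Lemma is_derive_shift_mul {R : realType} (c k x l l' : R) (f g : R -> R) :
  is_derive x (1 : R) f l -> is_derive x (1 : R) g l' ->
  is_derive x (1 : R) (fun s => (s + c) * f s + k * g s) (f x + (x + c) * l + k * l').
Proof.
move=> df dg.
by apply: is_derive_eq; rewrite /GRing.scale/=; ring.
Qed.

Lemma continuous_div {R : realType} {T : topologicalType} (n d : T -> R) (x : T) :
  {for x, continuous n} -> {for x, continuous d} -> d x != 0 ->
  {for x, continuous (fun z => n z / d z)}.
Proof. by move=> cn cd dx0; apply: (cvgM cn); apply: cvgV. Qed.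

Section shifted_field.
Context {R : realType}.
Variables (M C c : R) (f fx fy g gx gy : R * R -> R).
Hypotheses (M0 : 0 < M) (Hf : C1_supported M C f fx fy) (Hg : C1_supported M C g gx gy).

(** The quotient [W] is the case [c = 0]; the shift moves its singularity from the origin to
    [(- c, 0)]. *)
Definition shifted_integrand (p : R * R) : R :=
  ((p.1 + c) * fx p + p.2 * fy p + p.2 * gx p - (p.1 + c) * gy p) /
  ((p.1 + c) ^+ 2 + p.2 ^+ 2).

Let den (p : R * R) : R := (p.1 + c) ^+ 2 + p.2 ^+ 2.
(** With [s = x + c], the field [(P, Q)] is [f] times [(s, y) / den] plus [g] times
    [(y, - s) / den]. [Px] and [Qy] are the matching derivatives as the quotient rule produces
    them. *)
Let P (p : R * R) : R := ((p.1 + c) * f p + p.2 * g p) / den p.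
Let Q (p : R * R) : R := (p.2 * f p - (p.1 + c) * g p) / den p.
Let Px (p : R * R) : R :=
  ((f p + (p.1 + c) * fx p + p.2 * gx p) * den p -
   ((p.1 + c) * f p + p.2 * g p) * (2 * (p.1 + c))) / den p ^+ 2.
Let Qy (p : R * R) : R :=
  ((f p + p.2 * fy p - (p.1 + c) * gy p) * den p -
   (p.2 * f p - (p.1 + c) * g p) * (2 * p.2)) / den p ^+ 2.

Let cden (p : R * R) : {for p, continuous den}.
Proof.
by apply: cvgD; [apply: cvgM; apply: cvgD;
  [exact: cvg_fst|exact: cvg_cst|exact: cvg_fst|exact: cvg_cst]|apply: cvgM; exact: cvg_snd].
Qed.

Let cshift (p : R * R) : {for p, continuous (fun q : R * R => q.1 + c)}.
Proof. by apply: cvgD; [exact: cvg_fst|exact: cvg_cst]. Qed.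

Let csnd (p : R * R) : {for p, continuous (fun q : R * R => q.2)}.
Proof. exact: cvg_snd. Qed.

Let cf (p : R * R) : {for p, continuous f}. Proof. exact: C1s_continuous Hf p. Qed.
Let cg (p : R * R) : {for p, continuous g}. Proof. exact: C1s_continuous Hg p. Qed.

Let cPx p : den p != 0 -> {for p, continuous Px}.
Proof.
move=> d0; apply: continuous_div; last by rewrite sqrf_eq0.
  apply: cvgB; apply: cvgM; [|exact: cden| |].
  - apply: cvgD; last by apply: cvgM; [exact: csnd|exact: C1s_cx Hg p].
    by apply: cvgD; [exact: cf|apply: cvgM; [exact: cshift|exact: C1s_cx Hf p]].
  - by apply: cvgD; apply: cvgM; [exact: cshift|exact: cf|exact: csnd|exact: cg].
  - by apply: cvgM; [exact: cvg_cst|exact: cshift].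
by apply: cvgM; exact: cden.
Qed.

Let cQy p : den p != 0 -> {for p, continuous Qy}.
Proof.
move=> d0; apply: continuous_div; last by rewrite sqrf_eq0.
  apply: cvgB; apply: cvgM; [|exact: cden| |].
  - apply: cvgB; last by apply: cvgM; [exact: cshift|exact: C1s_cy Hg p].
    by apply: cvgD; [exact: cf|apply: cvgM; [exact: csnd|exact: C1s_cy Hf p]].
  - by apply: cvgB; apply: cvgM; [exact: csnd|exact: cf|exact: cshift|exact: cg].
  - by apply: cvgM; [exact: cvg_cst|exact: csnd].
by apply: cvgM; exact: cden.
Qed.

Lemma continuous_shifted_integrand p : den p != 0 -> {for p, continuous shifted_integrand}.
Proof.
move=> d0; apply: continuous_div; [|exact: cden|exact: d0].
apply: cvgB; last by apply: cvgM; [exact: cshift|exact: C1s_cy Hg p].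
apply: cvgD; last by apply: cvgM; [exact: csnd|exact: C1s_cx Hg p].
apply: cvgD; first by apply: cvgM; [exact: cshift|exact: C1s_cx Hf p].
by apply: cvgM; [exact: csnd|exact: C1s_cy Hf p].
Qed.

(* The field in [shifted_integrand] is divergence free, so the integrand is itself a divergence. *)
Let integrandE p : den p != 0 -> Px p + Qy p = shifted_integrand p.
Proof.
by move=> d0; rewrite /Px /Qy /shifted_integrand -/(den p); move: d0; rewrite /den => d0; field.
Qed.

Let dP p : den p != 0 -> is_derive p.1 (1 : R) (fun s => P (s, p.2)) (Px p).
Proof.
move=> d0; have := C1s_dx Hf p; have := C1s_dx Hg p; case: p d0 => x y d0 /= dg df.
apply: (is_derive_div (is_derive_shift_mul c y df dg) (is_derive_sqr_shift c (y ^+ 2) x)).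
exact: d0.
Qed.

Let dQ p : den p != 0 -> is_derive p.2 (1 : R) (fun s => Q (p.1, s)) (Qy p).
Proof.
move=> d0; have := C1s_dy Hf p; have := C1s_dy Hg p; case: p d0 => x y d0 /= dg df.
(* The roles of the variables are exchanged: the moving variable gets the shift 0, and [x + c]
   becomes a constant, so that the lemmas used for [P] apply again. *)
have E : (fun s => Q (x, s)) =
    (fun s => ((s + 0) * f (x, s) + - (x + c) * g (x, s)) / ((s + 0) ^+ 2 + (x + c) ^+ 2)).
  by apply/funext => s; rewrite /Q /den /= addr0 [in RHS](addrC (s ^+ 2)) mulNr.
rewrite E; have d1 : (y + 0) ^+ 2 + (x + c) ^+ 2 != 0 by rewrite addr0 addrC.
refine (@is_derive_eq _ _ _ _ _ _ _ _
  (is_derive_div (is_derive_shift_mul 0 (- (x + c)) df dg) (is_derive_sqr_shift 0 ((x + c) ^+ 2)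
    y) d1) _).
by move: d0 d1; rewrite /Qy /den /= !addr0 => d0 d1; field.
Qed.

(** The field vanishes on the horizontal edges, where [|y| = M], so only the vertical edges
    contribute. The condition on [x + c] keeps the singularity out of the box. *)
Lemma integral_shifted_integrand_box (a b : R) : a < b ->
  (forall x, x \in `[a, b] -> x + c != 0) ->
  (\int[leb2 R]_(p in `[a, b] `*` `[(- M)%R, M]) (shifted_integrand p)%:E =
   \int[@lebesgue_measure R]_(y in `[(- M)%R, M])
     (((b + c) * f (b, y) + y * g (b, y)) / ((b + c) ^+ 2 + y ^+ 2) -
      ((a + c) * f (a, y) + y * g (a, y)) / ((a + c) ^+ 2 + y ^+ 2))%:E)%E.
Proof.
move=> ab xc.
have d0 p : (`[a, b] `*` `[(- M)%R, M]) p -> den p != 0.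
  move=> [/xc p0 _]; rewrite /den gt_eqF// ltr_wpDr ?sqr_ge0//.
  by rewrite lt_neqAle sqr_ge0 eq_sym sqrf_eq0 p0.
transitivity (\int[leb2 R]_(p in `[a, b] `*` `[(- M)%R, M]) (Px p + Qy p)%:E)%E.
  by apply: eq_integral => p; rewrite inE => /d0/integrandE ->.
have MM : - M < M by rewrite (@lt_trans _ _ 0) // oppr_lt0.
rewrite (divergence_box ab MM (fun p h => dP (d0 p h)) (fun p h => dQ (d0 p h))
  (fun p h => cPx (d0 p h)) (fun p h => cQy (d0 p h))).
rewrite [X in (_ + X)%E](_ : _ = 0%E) ?adde0//.
apply: integral0_eq => x _.
have [|f1 _ _] := @C1s_out _ _ _ _ _ _ Hf (x, M); first by right; rewrite /= ger0_norm// ltW.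
have [|f2 _ _] := @C1s_out _ _ _ _ _ _ Hf (x, - M); first by right;
  rewrite /= normrN ger0_norm// ltW.
have [|g1 _ _] := @C1s_out _ _ _ _ _ _ Hg (x, M); first by right; rewrite /= ger0_norm// ltW.
have [|g2 _ _] := @C1s_out _ _ _ _ _ _ Hg (x, - M); first by right;
  rewrite /= normrN ger0_norm// ltW.
by rewrite /Q /= f1 f2 g1 g2 !mulr0 !(subr0, mul0r, addr0).
Qed.

End shifted_field.

(** * The Poisson kernel *)

Section poisson_kernel.
Context {R : realType}.
Notation mu := (@lebesgue_measure R).
Variables (M : R) (u u' : R -> R).
Hypotheses (M0 : 0 < M) (du : forall y, is_derive y (1 : R) u (u' y)) (cu' : continuous u')
  (uM : u M = 0) (uNM : u (- M) = 0).

Let I : set R := `[- M, M]%classic.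
Let NMM : - M < M. Proof. by rewrite (@lt_trans _ _ 0)// oppr_lt0. Qed.
Let mI : @measurable _ (measurableTypeR R) I. Proof. exact: measurable_itv. Qed.
Let cu : continuous u. Proof. by move=> y; apply: is_derive_continuous (du y). Qed.

Let integrableI (h : R -> R) : continuous h -> mu.-integrable I (EFin \o h).
Proof.
by move=> ch; apply: continuous_compact_integrable;
  [exact: segment_compact|exact: continuous_subspaceT].
Qed.

Let is_derive_atan_scale (e y : R) : is_derive y (1 : R) (fun s => atan (s / e)) (e^-1 * (1 + (y
  / e) ^+ 2)^-1).
Proof.
have d1 : is_derive y (1 : R) (fun s => s / e) e^-1.
  by apply: is_derive_eq; rewrite /GRing.scale/=; ring.
have d2 := @is_derive1_comp R atan (fun s => s / e) y _ _ _ d1.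
by apply: is_derive_eq (d2 _ (is_derive1_atan _)) _; rewrite mulrC.
Qed.

Let catan (e : R) : continuous (fun y : R => atan (y / e)).
Proof. by move=> y; apply: is_derive_continuous (is_derive_atan_scale e y). Qed.

(* Integration by parts: [e / (e ^ 2 + y ^ 2)] is the derivative of [atan (y / e)]. *)
Lemma integral_poisson_kernel (e : R) : 0 < e ->
  (\int[mu]_(y in I) (2 * (e * u y) / (e ^+ 2 + y ^+ 2))%:E =
   \int[mu]_(y in I) (- (2 * (u' y * atan (y / e))))%:E)%E.
Proof.
move=> e0.
pose A (y : R) : R := 2 * (u' y * atan (y / e)).
pose B (y : R) : R := 2 * (e * u y) / (e ^+ 2 + y ^+ 2).
have den0 y : e ^+ 2 + y ^+ 2 != 0 by rewrite gt_eqF// ltr_wpDr ?sqr_ge0// exprn_gt0.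
have cA : continuous A.
  move=> y; apply: cvgM; [exact: cvg_cst|].
  by apply: cvgM; [exact: cu'|exact: catan].
have cB : continuous B.
  move=> y; apply: (@continuous_div R _ (fun y : R => 2 * (e * u y)) (fun y : R => e ^+ 2 + y ^+
    2) y) => //.
    by apply: cvgM; [exact: cvg_cst|apply: cvgM; [exact: cvg_cst|exact: cu]].
  by apply: cvgD; [exact: cvg_cst|apply: cvgM; exact: cvg_id].
have D y : is_derive y (1 : R) (fun s => 2 * (u s * atan (s / e))) (A y + B y).
  have d1 := du y; have d2 := is_derive_atan_scale e y.
  apply: is_derive_eq; rewrite /A /B /GRing.scale/=.
  have := den0 y; have e0' := lt0r_neq0 e0 => d0.
  by field; rewrite d0.
(* [A + B] is the derivative of [2 u(y) atan (y / e)], which is zero at both ends of the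
   interval. *)
have : (\int[mu]_(y in I) (A y + B y)%:E = 0)%E.
  rewrite (@integral_is_derive R (fun s => 2 * (u s * atan (s / e)))).
  - by rewrite uM uNM !mul0r !mulr0 subrr.
  - exact: NMM.
  - by move=> y _; exact: D.
  - by move=> y _; apply: cvgD; [exact: cA|exact: cB].
under eq_integral do rewrite EFinD.
have iA := integrableI cA; have iB := integrableI cB.
rewrite (integralD mI iA iB) => AB.
under [RHS]eq_integral do rewrite EFinN.
have fA : (\int[mu]_(y in I) (A y)%:E)%E \is a fin_num := integrable_fin_num mI iA.
have fB : (\int[mu]_(y in I) (B y)%:E)%E \is a fin_num := integrable_fin_num mI iB.
rewrite integralN/=; last exact/integrable_add_def.
move: AB; rewrite -(fineK fA) -(fineK fB) -EFinD -EFinN => -[AB].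
by congr EFin; apply/eqP; rewrite -addr_eq0 addrC AB.
Qed.

(** After the integration by parts, [e] occurs only in [atan (y / e)], which is bounded and tends to
    [pi / 2] times the sign of [y]. Dominated convergence leaves the integral of [- pi u'(y) sgn y],
    in which each half-line contributes [pi u(0)]. *)
Lemma cvg_poisson_kernel :
  (\int[mu]_(y in I) (2 * (n.+1%:R^-1 * u y) / (n.+1%:R^-1 ^+ 2 + y ^+ 2))%:E)%E
    @[n --> \oo] --> (2 * pi * u 0)%:E.
Proof.
have e0 n : (0 : R) < n.+1%:R^-1 by rewrite invr_gt0 ltr0Sn.
rewrite (_ : (fun n => _) = fun n : nat => (\int[mu]_(y in I) (- (2 * (u' y * atan (y *
  n.+1%:R))))%:E)%E); last first.
  apply/funext => n; rewrite integral_poisson_kernel//; apply: eq_integral => y _.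
  by rewrite invrK.
have [C uC] := @bounded_continuous_compact R _ I u' (segment_compact (a := - M) (b := M))
  (continuous_subspaceT cu').
pose g y : R := - (pi * (u' y * Num.sg y)).
have cvg_sg (y : R) : atan (y * n.+1%:R) @[n --> \oo] --> pi / 2 * Num.sg y.
  have ny : (n.+1%:R : R) @[n --> \oo] --> +oo by rewrite (cvg_shiftS (fun n => n%:R : R));
    exact: cvgr_idn.
  have atany z : 0 < z -> atan (z * n.+1%:R) @[n --> \oo] --> (pi / 2 : R).
    move=> z0; have h1 : z * x @[x --> +oo] --> +oo by exact: gt0_cvgMry z0 cvg_id.
    have h2 : (@atan R) x @[x --> +oo] --> pi / 2 by exact: cvgy_atan.
    exact: (cvg_comp (fun n : nat => n.+1%:R : R) (fun x => atan (z * x)) ny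
      (cvg_comp (fun x => z * x) (@atan R) h1 h2)).
  have [y0|y0|->] := ltgtP y 0.
  - rewrite ltr0_sg// mulrN1 -[y]opprK.
    under eq_fun do rewrite mulNr atanN.
    by apply: cvgN; apply: atany; rewrite oppr_gt0.
  - by rewrite gtr0_sg// mulr1; exact: atany.
  (* At 0 the sequence is constantly 0, in agreement with [Num.sg 0 = 0]. *)
  - by under eq_fun do rewrite mul0r atan0; rewrite sgr0 mulr0; exact: cvg_cst.
pose fn (n : nat) (y : R) : R := - (2 * (u' y * atan (y * n.+1%:R))).
have cvgg y : fn n y @[n --> \oo] --> g y.
  rewrite /g (_ : pi * _ = 2 * (u' y * (pi / 2 * Num.sg y))); last by field.
  apply: cvgN; apply: cvgM; first exact: cvg_cst.
  by apply: cvgM; first exact: cvg_cst.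
have mfn n : measurable_fun setT (fn n).
  apply: continuous_measurable_fun => y; apply: cvgN; apply: cvgM; first exact: cvg_cst.
  apply: cvgM; first exact: cu'.
  by move: (@catan n.+1%:R^-1 y); under eq_fun do rewrite invrK; exact.
have mg : measurable_fun setT g by apply: (measurable_fun_cvg mfn) => y _; exact: cvgg.
have [|||||ig _] := @dominated_convergence _ (measurableTypeR R) R mu I mI
  (fun n y => (fn n y)%:E) (EFin \o g) (cst (pi * C)%:E).
- by move=> n; apply/measurable_EFinP; apply: measurable_funTS; exact: mfn.
- by apply/measurable_EFinP; apply: measurable_funTS; exact: mg.
- by apply: aeW => y _; apply: cvg_EFin; [exact: nearW|exact: cvgg].
- by apply: integrableI; exact: cst_continuous.
- apply: aeW => y n yI; rewrite /fn /= lee_fin normrN !normrM gtr0_norm//.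
  have at2 : `|atan (y * n.+1%:R)| <= pi / 2.
    by rewrite ler_norml (ltW (atan_gtNpi2 _)) (ltW (atan_ltpi2 _)).
  have := ler_pM (normr_ge0 _) (normr_ge0 _) (uC y yI) at2; lra.
move=> +; congr (_ --> _).
(* The interval is cut at 0, so that the sign is constant on either side up to the single point
   0. *)
rewrite /I (@itv_bndbnd_setU _ _ _ (BLeft 0)) ?bnd_simp ?oppr_le0 ?ltW//.
rewrite integral_setU//; last 2 first.
- by apply/measurable_EFinP; apply: measurable_funTS; exact: mg.
- by apply/disj_setPS => y [/=]; rewrite !in_itv/= => /andP[_ y0] /andP[]; rewrite leNgt y0.
have mu' : measurable_fun setT u' by exact: continuous_measurable_fun.
have mpu : measurable_fun setT (fun y => pi * u' y) by exact: measurable_funM.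
rewrite (@eq_integral_itv_bounded R (- M) 0 (fun y => pi * u' y) g)//=; last 3 first.
- exact: measurable_funTS mg.
- exact: measurable_funTS mpu.
- by move=> y; rewrite in_itv/= => /andP[_ y0]; rewrite /g ltr0_sg// mulrN1 mulrN opprK.
rewrite (@eq_integral_itv_bounded R 0 M (fun y => - (pi * u' y)) g)//=; last 3 first.
- exact: measurable_funTS mg.
- by apply: measurableT_comp => //; exact: measurable_funTS mpu.
- by move=> y; rewrite in_itv/= => /andP[y0 _]; rewrite /g gtr0_sg// mulr1.
rewrite integral_itv_bndo_bndc; last by apply/measurable_EFinP; exact: measurable_funTS mpu.
have cpu : continuous (fun y => pi * u' y) by move=> y; apply: cvgM;
  [exact: cvg_cst|exact: cu'].
rewrite (@integral_is_derive R (fun y => pi * u y))//; last 3 first.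
- by rewrite oppr_lt0.
- by move=> y _; have := du y => d; apply: is_derive_eq; rewrite /GRing.scale/=; ring.
- by move=> y _; exact: cpu.
rewrite (@integral_is_derive R (fun y => - (pi * u y)))//; last 2 first.
- by move=> y _; have := du y => d; apply: is_derive_eq; rewrite /GRing.scale/=; ring.
- by move=> y _; apply: cvgN; exact: cpu.
by rewrite uM uNM -EFinD; congr EFin; ring.
Qed.

End poisson_kernel.

(** * The bulk integral *)

(** Monotone convergence along an exhaustion by segments bounds an improper integral: the primitive
    is needed on the segments only, not at the singular end. *)
Lemma integral_bigcup_primitive_le {R : realType} (a b : nat -> R) (F h : R -> R) (K : R) :
  (forall n, a n < b n) ->
  nondecreasing_seq (fun n => `[a n, b n]%classic) ->
  (forall n x, x \in `[a n, b n] -> is_derive x (1 : R) F (h x)) ->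
  (forall n x, x \in `[a n, b n] -> {for x, continuous h}) ->
  (forall x, 0 <= h x) ->
  (forall n, F (b n) - F (a n) <= K) ->
  (\int[@lebesgue_measure R]_(x in \bigcup_n `[a n, b n]%classic) (h x)%:E <= K%:E)%E.
Proof.
move=> ab nd dF ch h0 FK.
have mh n : measurable_fun (`[a n, b n]%classic : set R) h.
  apply: subspace_continuous_measurable_fun => //.
  by apply: continuous_in_subspaceT => x; rewrite inE; exact: ch.
have H : (\int[@lebesgue_measure R]_(x in `[a n, b n]) (h x)%:E)%E @[n --> \oo] -->
    (\int[@lebesgue_measure R]_(x in \bigcup_n `[a n, b n]%classic) (h x)%:E)%E.
  apply: (@ge0_nondecreasing_set_cvg_integral _ (measurableTypeR R) R
    (fun n => `[a n, b n]%classic) (EFin \o h) (@lebesgue_measure R) nd).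
  - by move=> n; exact: measurable_itv.
  - by move=> n; apply/measurable_EFinP; exact: mh.
  - by move=> n x _; rewrite lee_fin.
rewrite -(cvg_lim _ H)//; apply: lime_le; first by apply/cvg_ex; eexists; exact: H.
apply: nearW => n; rewrite /= (@integral_is_derive R F h)//.
- by rewrite lee_fin.
- by move=> x; exact: dF.
- by move=> x; exact: ch.
Qed.

(** By Tonelli, the iterated integral of the absolute value factors into two finite integrals, after
    extension by zero. *)
Lemma integrable_product {R : realType} (A B : set R) (g h : R -> R) :
  measurable A -> measurable B ->
  (@lebesgue_measure R).-integrable A (EFin \o g) ->
  (@lebesgue_measure R).-integrable B (EFin \o h) ->
  (leb2 R).-integrable (A `*` B) (fun p => (g p.1 * h p.2)%:E).
Proof.
move=> mA mB ig ih.
have mAB : @measurable _ (plane R) (A `*` B) by exact: measurableX.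
apply: (proj2 (integrable_mkcond _ mAB)).
have iG := proj1 (integrable_mkcond (T := measurableTypeR R) _ mA) ig.
have iH := proj1 (integrable_mkcond (T := measurableTypeR R) _ mB) ih.
have E (p : R * R) : ((fun p => (g p.1 * h p.2)%:E) \_ (A `*` B)) p =
    (((EFin \o g) \_ A) p.1 * ((EFin \o h) \_ B) p.2)%E.
  rewrite !patchE in_setX; case: (p.1 \in A); case: (p.2 \in B) => /=;
  by rewrite ?EFinM ?mule0 ?mul0e.
have mG := measurable_int _ iG; have mH := measurable_int _ iH.
apply/integrable12ltyP.
  rewrite (_ : _ \_ _ = (fun p : R * R => (((EFin \o g) \_ A) p.1 * ((EFin \o h) \_ B) p.2)%E));
    last exact/funext.
  by apply: emeasurable_funM; apply: measurableT_comp => //.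
pose K := (\int[@lebesgue_measure R]_y `|((EFin \o h) \_ B) y|)%E.
have K0 : (0 <= K)%E by exact: integral_ge0.
have mG' : measurable_fun setT (fun x => `|((EFin \o g) \_ A) x|%E) by exact: measurableT_comp.
have mH' : measurable_fun setT (fun x => `|((EFin \o h) \_ B) x|%E) by exact: measurableT_comp.
have E2 x : (\int[@lebesgue_measure R]_y
    `|((fun p => (g p.1 * h p.2)%:E) \_ (A `*` B)) (x, y)| = `|((EFin \o g) \_ A) x| * K)%E.
  under eq_integral do rewrite E /= abseM.
  by rewrite ge0_integralZl.
under eq_integral do rewrite E2.
rewrite ge0_integralZr// lte_mul_pinfty ?integral_ge0//.
  by apply: integrable_fin_num => //; exact: integrable_abse.
by apply: integrable_lty => //; exact: integrable_abse.
Qed.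

(** * An integrable majorant with inverse square root singularities *)

Definition inv_sqrt_norm {R : realType} (x : R) : R := (Num.sqrt `|x|)^-1.

Lemma continuous_inv_sqrt_norm {R : realType} (x : R) : x != 0 ->
  {for x, continuous (@inv_sqrt_norm R)}.
Proof.
move=> x0; apply: cvgV; first by rewrite sqrtr_eq0 -ltNge normr_gt0.
apply: (@continuous_comp _ _ _ (fun x : R => `|x|) Num.sqrt).
  exact: norm_continuous.
exact: sqrt_continuous.
Qed.

Lemma measurable_inv_sqrt_norm {R : realType} (A : set R) : measurable A ->
  (forall x, A x -> x != 0) -> measurable_fun A (@inv_sqrt_norm R).
Proof.
move=> mA A0; have oN : open [set x : R | x != 0] by exact: open_neq.
have mN := open_measurable oN.
have mf : measurable_fun [set x : R | x != 0] (@inv_sqrt_norm R).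
  by apply: open_continuous_measurable_fun => // x; rewrite inE;
    exact: continuous_inv_sqrt_norm.
exact: (measurable_funS mN A0 mf).
Qed.

(** The primitive is [2 sqrt x], used on segments that exhaust the interval from the right. *)
Lemma integral_inv_sqrt_pos {R : realType} (M : R) : 0 < M ->
  (\int[@lebesgue_measure R]_(x in `]0%R, M]) (inv_sqrt_norm x)%:E <= (2 * Num.sqrt M)%:E)%E.
Proof.
move=> M0.
(* Starting the denominators at 2 keeps every segment nondegenerate. *)
pose a (n : nat) : R := M / n.+2%:R.
have a0 n : 0 < a n by rewrite divr_gt0.
have -> : `]0, M]%classic = \bigcup_n `[a n, M]%classic.
  apply/seteqP; split=> x /=; rewrite ?in_itv/=.
    (* For this index [n] one has [M / x < n + 1 < n + 2], hence [a n <= x]. *)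
    move=> /andP[x0 xM]; exists (Num.truncn (M / x)) => //=.
    rewrite in_itv/= xM andbT /a ler_pdivrMr// mulrC -ler_pdivrMr// ltW//.
    by rewrite (lt_trans (truncnS_gt _))// ltr_nat.
  by move=> [n _] /=; rewrite in_itv/= => /andP[/(lt_le_trans (a0 n)) -> ->].
apply: (@integral_bigcup_primitive_le R a (fun=> M) (fun x => 2 * Num.sqrt x) (@inv_sqrt_norm
  R)).
- by move=> n; rewrite /a ltr_pdivrMr// ltr_pMr// (ltr_nat R 1).
- move=> m n mn; rewrite subsetEset => x /=; rewrite !in_itv/= => /andP[ax ->]; rewrite andbT.
  by apply: le_trans ax; rewrite /a ler_pM2l// lef_pV2 ?posrE// ler_nat !ltnS.
- move=> n x; rewrite in_itv/= => /andP[/(lt_le_trans (a0 n)) x0 _].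
  have d : is_derive x (1 : R) Num.sqrt (2 * Num.sqrt x)^-1 by exact: is_derive1_sqrt.
  apply: is_derive_eq; rewrite /inv_sqrt_norm gtr0_norm// /GRing.scale/=.
  have : Num.sqrt x != 0 by rewrite sqrtr_eq0 -ltNge.
  by move=> ?; field.
- move=> n x; rewrite in_itv/= => /andP[/(lt_le_trans (a0 n)) x0 _].
  by apply: continuous_inv_sqrt_norm; rewrite gt_eqF.
- by move=> x; rewrite invr_ge0 sqrtr_ge0.
- by move=> n; rewrite gerBl mulr_ge0// sqrtr_ge0.
Qed.

Lemma integral_inv_sqrt_neg {R : realType} (M : R) : 0 < M ->
  (\int[@lebesgue_measure R]_(x in `[(- M)%R, 0%R[) (inv_sqrt_norm x)%:E <= (2 * Num.sqrt
    M)%:E)%E.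
Proof.
move=> M0.
pose a (n : nat) : R := - (M / n.+2%:R).
have a0 n : a n < 0 by rewrite oppr_lt0 divr_gt0.
have -> : `[(- M)%R, 0%R[%classic = \bigcup_n `[- M, a n]%classic.
  apply/seteqP; split=> x /=; rewrite ?in_itv/=.
    move=> /andP[xM x0]; exists (Num.truncn (M / - x)) => //=.
    rewrite in_itv/= xM /a lerNr ler_pdivrMr// mulrC -ler_pdivrMr ?oppr_gt0// ltW//.
    by rewrite (lt_trans (truncnS_gt _))// ltr_nat.
  by move=> [n _] /=; rewrite in_itv/= => /andP[->] /le_lt_trans /(_ (a0 n)) ->.
apply: (@integral_bigcup_primitive_le R (fun=> - M) a (fun x => - (2 * Num.sqrt (- x)))
  (@inv_sqrt_norm R)).
- by move=> n; rewrite /a ltrN2 ltr_pdivrMr// ltr_pMr// (ltr_nat R 1).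
- move=> m n mn; rewrite subsetEset => x /=; rewrite !in_itv/= => /andP[-> ax] /=.
  by apply: (le_trans ax); rewrite /a lerN2 ler_pM2l// lef_pV2 ?posrE// ler_nat !ltnS.
- move=> n x; rewrite in_itv/= => /andP[_ /le_lt_trans /(_ (a0 n)) x0].
  have x0' : 0 < - x by rewrite oppr_gt0.
  have d1 : is_derive x (1 : R) (fun s : R => - s) (- 1) by apply: is_derive_eq.
  have d2 := @is_derive1_comp R Num.sqrt (fun s : R => - s) x _ _ (is_derive1_sqrt x0') d1.
  have d3 : is_derive x (1 : R) (fun s : R => Num.sqrt (- s)) ((2 * Num.sqrt (- x))^-1 * - 1) by
    exact: d2.
  apply: is_derive_eq; rewrite /inv_sqrt_norm ltr0_norm// /GRing.scale/=.
  have : Num.sqrt (- x) != 0 by rewrite sqrtr_eq0 -ltNge.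
  by move=> ?; field.
- move=> n x; rewrite in_itv/= => /andP[_ /le_lt_trans /(_ (a0 n)) x0].
  by apply: continuous_inv_sqrt_norm; rewrite lt_eqF.
- by move=> x; rewrite invr_ge0 sqrtr_ge0.
- by move=> n; rewrite !opprK addrC gerBl mulr_ge0// sqrtr_ge0.
Qed.

Lemma integrable_inv_sqrt_norm {R : realType} (M : R) : 0 < M ->
  (@lebesgue_measure R).-integrable (`[- M, 0[ `|` `]0, M]) (EFin \o @inv_sqrt_norm R).
Proof.
move=> M0.
have m1 : measurable_fun `[- M, 0[%classic (@inv_sqrt_norm R).
  by apply: measurable_inv_sqrt_norm => // x /=; rewrite in_itv/= => /andP[_ x0];
    rewrite lt_eqF.
have m2 : measurable_fun `]0, M]%classic (@inv_sqrt_norm R).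
  by apply: measurable_inv_sqrt_norm => // x /=; rewrite in_itv/= => /andP[x0 _];
    rewrite gt_eqF.
have mU : measurable_fun (`[- M, 0[ `|` `]0, M]) (@inv_sqrt_norm R) by apply/measurable_funU.
apply/integrableP; split; first exact/measurable_EFinP.
have pos x : (`|(inv_sqrt_norm x)%:E| = (inv_sqrt_norm x)%:E :> \bar R)%E.
  by rewrite /= ger0_norm// invr_ge0 sqrtr_ge0.
under eq_integral do rewrite pos.
rewrite ge0_integral_setU//.
- apply: le_lt_trans (leeD (integral_inv_sqrt_neg M0) (integral_inv_sqrt_pos M0)) _.
  by rewrite -EFinD ltry.
- exact/measurable_EFinP.
- by move=> x _; rewrite lee_fin invr_ge0 sqrtr_ge0.
- by apply/disj_setPS => y [/=]; rewrite !in_itv/= => /andP[_ y0] /andP[];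
  rewrite ltNge (ltW y0).
Qed.

(** * Changing the domain of integration by a null set *)

Section off_null_set.
Context d (T : measurableType d) (R : realType) (mu : {measure set T -> \bar R}).
Variables (D1 D2 N : set T) (f : T -> \bar R).
Hypotheses (mD1 : measurable D1) (mD2 : measurable D2) (mN : measurable N) (N0 : mu N = 0%E).
Hypotheses (mf1 : measurable_fun D1 f) (mf2 : measurable_fun D2 f).

(** Comparing the extensions by zero allows the two domains to differ outside [N] too, provided that
    the function vanishes where they do. *)
Lemma integral_eq_off_null :
  (forall p, ~ N p -> (f \_ D1) p = (f \_ D2) p) ->
  (\int[mu]_(p in D1) f p = \int[mu]_(p in D2) f p)%E.
Proof.
move=> fE; rewrite integral_mkcond [RHS]integral_mkcond.
apply: ae_eq_integral => //; [exact/(measurable_restrictT _ _).1|exact/(measurable_restrictT _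
  _).1|].
by exists N; split => // p /=; apply: contra_notP => /fE.
Qed.
End off_null_set.

Lemma integrable_eq_off_null d (T : measurableType d) (R : realType) (mu : {measure set T ->
  \bar R})
    (D1 D2 N : set T) (f : T -> \bar R) :
  measurable D1 -> measurable D2 -> measurable N -> mu N = 0%E ->
  measurable_fun D1 f -> measurable_fun D2 f ->
  (forall p, ~ N p -> (f \_ D1) p = (f \_ D2) p) ->
  mu.-integrable D2 f -> mu.-integrable D1 f.
Proof.
move=> mD1 mD2 mN N0 mf1 mf2 fE /integrableP[_ if2]; apply/integrableP; split => //.
rewrite (@integral_eq_off_null _ _ _ mu D1 D2 N (fun p => `|f p|%E))//.
- exact: measurableT_comp.
- exact: measurableT_comp.
- move=> p Np; have absP D : ((fun p => `|f p|%E) \_ D) p = `|(f \_ D) p|%E.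
    by rewrite !patchE; case: ifP => // _; rewrite abse0.
  by rewrite !absP fE.
Qed.

(** * Domination of the shifted integrands and passage to the limit *)

Section cracktip_field.
Context {R : realType}.
Variables (M C : R) (f fx fy g gx gy : R * R -> R).
Hypotheses (M0 : 0 < M) (Hf : C1_supported M C f fx fy) (Hg : C1_supported M C g gx gy).

Notation W c := (shifted_integrand c fx fy gx gy).
(** The point 0 is removed so that products with [S] avoid the axes, where the majorant is singular;
    the axes form a null set. *)
Let S : set R := `[- M, 0[ `|` `]0, M].
Let axes : set (R * R) := ([set 0] `*` setT) `|` (setT `*` [set 0]).

Let mS : @measurable _ (measurableTypeR R) S.
Proof. by apply: measurableU; exact: measurable_itv. Qed.

Let S0 x : S x -> x != 0.
Proof. by case; rewrite /= in_itv/= => /andP[x0 x1]; rewrite ?(lt_eqF x1)// gt_eqF. Qed.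

Let SM x : S x -> x \in `[- M, M].
Proof.
by case; rewrite /= !in_itv/= => /andP[x0 x1]; apply/andP; split=> //;
  rewrite ?(ltW (lt_trans x1 M0))// (le_trans _ (ltW x0))// oppr_le0 ltW.
Qed.

Let maxes : @measurable _ (plane R) axes.
Proof.
apply: measurableU; apply: (@measurableX _ _ (measurableTypeR R) (measurableTypeR R)) => //;
  exact: (@measurable_set1 R).
Qed.

Let axes0 : leb2 R axes = 0%E.
Proof.
have m0 : @measurable _ (measurableTypeR R) [set 0] by exact: (@measurable_set1 R).
have E1 : leb2 R ([set 0] `*` setT) = (@lebesgue_measure R [set 0%R] * @lebesgue_measure R
  setT)%E.
  by apply: product_measure1E.
have E2 : leb2 R (setT `*` [set 0]) = (@lebesgue_measure R setT * @lebesgue_measure R [set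
  0%R])%E.
  by apply: product_measure1E.
apply: null_set_setU; [exact: measurableX|exact: measurableX| |].
- by apply: (etrans E1); rewrite lebesgue_measure_set1 mul0e.
- by apply: (etrans E2); rewrite lebesgue_measure_set1 mule0.
Qed.

Let den_neq0 c (p : R * R) : p.2 != 0 -> (p.1 + c) ^+ 2 + p.2 ^+ 2 != 0.
Proof.
by move=> p2; rewrite gt_eqF// ltr_wpDl ?sqr_ge0// lt_neqAle sqr_ge0 eq_sym sqrf_eq0 p2.
Qed.

Let measurableW c (D : set (R * R)) : measurable D ->
  (forall p, D p -> (p.1 + c) ^+ 2 + p.2 ^+ 2 != 0) -> measurable_fun D (W c).
Proof.
move=> mD D0; apply: measurable_fun_continuous_at => // p /D0.
exact: (continuous_shifted_integrand Hf Hg).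
Qed.

(** The numerator is at most [2 C (|s| + |y|)] with [s = x + c], and [(|s| + |y|) sqrt (|x| |y|) <=
    2 (s ^ 2 + y ^ 2)]. The hypothesis [|x| <= |x + c|] makes the bound independent of [c]. *)
Let W_bound c p : p.1 != 0 -> p.2 != 0 -> `|p.1| <= `|p.1 + c| ->
  `|W c p| <= 4 * C * (inv_sqrt_norm p.1 * inv_sqrt_norm p.2).
Proof.
move=> p1 p2 pc; rewrite /shifted_integrand.
have C0 : 0 <= C by apply: le_trans (C1s_bx Hf p).
set s := p.1 + c in pc *; set y := p.2 in p2 *.
have n0 : `|s * fx p + y * fy p + y * gx p - s * gy p| <= 2 * C * (`|s| + `|y|).
  have h (a b : R) : `|b| <= C -> `|a * b| <= C * `|a| by move=> bC;
    rewrite normrM mulrC ler_wpM2r.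
  have h1 := h s _ (C1s_bx Hf p); have h2 := h y _ (C1s_by Hf p).
  have h3 := h y _ (C1s_bx Hg p); have h4 := h s _ (C1s_by Hg p).
  have := ler_normB (s * fx p + y * fy p + y * gx p) (s * gy p).
  have := ler_normD (s * fx p + y * fy p) (y * gx p).
  have := ler_normD (s * fx p) (y * fy p).
  lra.
have x0 : 0 < Num.sqrt `|p.1| by rewrite sqrtr_gt0 normr_gt0.
have y0 : 0 < Num.sqrt `|y| by rewrite sqrtr_gt0 normr_gt0.
have d0 : 0 < s ^+ 2 + y ^+ 2 by rewrite lt_neqAle eq_sym den_neq0//= addr_ge0 ?sqr_ge0.
rewrite /inv_sqrt_norm -invfM normrM normfV (gtr0_norm d0) ler_pdivrMr//.
apply: le_trans n0 _.
rewrite [leRHS]mulrAC ler_pdivlMr ?mulr_gt0//.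
(* [|x| |y| <= x ^ 2 + y ^ 2 <= s ^ 2 + y ^ 2] *)
have e1 : (Num.sqrt `|p.1| * Num.sqrt `|y|) ^+ 2 <= s ^+ 2 + y ^+ 2.
  rewrite exprMn !sqr_sqrtr ?normr_ge0//.
  rewrite -(real_normK (num_real s)) -(real_normK (num_real y)).
  have := ler_wpM2r (normr_ge0 y) pc; have := normr_ge0 s; have := normr_ge0 y; nra.
have e2 : (`|s| + `|y|) ^+ 2 <= 2 * (s ^+ 2 + y ^+ 2).
  rewrite -(real_normK (num_real s)) -(real_normK (num_real y)).
  by have := sqr_ge0 (`|s| - `|y|); rewrite sqrrB sqrrD; lra.
set r := _ * _ in e1 *.
(* The squares of the two factors are at most [2 (s ^ 2 + y ^ 2)] and [s ^ 2 + y ^ 2], and a product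
   is at most half the sum of the squares. *)
have : (`|s| + `|y|) * r <= 2 * (s ^+ 2 + y ^+ 2) by nra.
move=> /(ler_wpM2l (mulr_ge0 (ler0n _ 2) C0)); rewrite -[2%:R]/(2 : R); lra.
Qed.

Let cvgW (c : nat -> R) p : c @ \oo --> (0 : R) -> p.2 != 0 -> W (c n) p @[n --> \oo] --> W 0 p.
Proof.
move=> c0 p2; have cs : p.1 + c n @[n --> \oo] --> p.1 + 0 by apply: cvgD => //; exact: cvg_cst.
apply: cvgM.
  apply: cvgB; last by apply: cvgM => //; exact: cvg_cst.
  apply: cvgD; last exact: cvg_cst.
  by apply: cvgD; [apply: cvgM => //|]; exact: cvg_cst.
apply: cvgV; first exact: den_neq0.
by apply: cvgD; [apply: cvgM|exact: cvg_cst].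
Qed.

(** Dominated convergence with the product majorant. The last hypothesis dictates the sign of the
    shift: away from the origin on each half-plane. *)
Lemma cvg_integral_shifted (A : set R) (c : nat -> R) :
  measurable A -> A `<=` S -> c @ \oo --> (0 : R) ->
  (forall n x, A x -> `|x| <= `|x + c n|) ->
  (leb2 R).-integrable (A `*` S) (EFin \o W 0) /\
  (\int[leb2 R]_(p in A `*` S) (W (c n) p)%:E)%E @[n --> \oo] -->
    (\int[leb2 R]_(p in A `*` S) (W 0 p)%:E)%E.
Proof.
move=> mA AS c0 Ac.
have mAS : @measurable _ (plane R) (A `*` S) by exact: measurableX.
have mW k : measurable_fun (A `*` S) (W k).
  by apply: measurableW => // p [_ /S0]; exact: den_neq0.
have igA : (@lebesgue_measure R).-integrable A (EFin \o @inv_sqrt_norm R).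
  exact: integrableS (integrable_inv_sqrt_norm M0).
have [|||||iW _ cW] := @dominated_convergence _ (plane R) R (leb2 R) (A `*` S) mAS
  (fun n p => (W (c n) p)%:E) (EFin \o W 0)
  (fun p => (4 * C * (inv_sqrt_norm p.1 * inv_sqrt_norm p.2))%:E).
- by move=> n; apply/measurable_EFinP; exact: mW.
- by apply/measurable_EFinP; exact: mW.
- apply: aeW => p [_ /S0 p2]; apply: cvg_EFin; [exact: nearW|exact: cvgW].
- under [X in _.-integrable _ X]eq_fun do rewrite EFinM.
  by apply: integrableZl => //; apply: integrable_product => //;
    exact: integrable_inv_sqrt_norm.
- apply: aeW => p n [Ap Sp]; rewrite lee_fin.
  by apply: W_bound; [exact: S0 (AS _ Ap)|exact: S0|exact: Ac].
by split.
Qed.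

Let patch_iff (D1 D2 : set (R * R)) (h : R * R -> \bar R) p :
  (D1 p <-> D2 p) -> (h \_ D1) p = (h \_ D2) p.
Proof.
move=> D12; rewrite !patchE (_ : (p \in D1) = (p \in D2))//.
by apply/idP/idP; rewrite !inE => /D12.
Qed.

Let S_iff x : x != 0 -> (S x <-> x \in `[- M, M]).
Proof.
move=> x0; split; first exact: SM.
rewrite in_itv/= => /andP[Mx xM]; move: x0; rewrite neq_lt => /orP[x0|x0].
  by left; rewrite /= in_itv/= Mx.
by right; rewrite /= in_itv/= x0.
Qed.

Let normM : `|M| = M. Proof. by rewrite ger0_norm// ltW. Qed.

Let not_axes p : ~ axes p -> p.1 != 0 /\ p.2 != 0.
Proof. by move=> /not_orP[/= a b]; split; apply/eqP => e; [apply: a|apply: b]. Qed.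

Let f_out x y : M <= `|x| -> f (x, y) = 0.
Proof. by move=> Mx; have [|-> _ _] := @C1s_out _ _ _ _ _ _ Hf (x, y) => //; left. Qed.

Let g_out x y : M <= `|x| -> g (x, y) = 0.
Proof. by move=> Mx; have [|-> _ _] := @C1s_out _ _ _ _ _ _ Hg (x, y) => //; left. Qed.

(** The majorant lives off the axes, whereas the divergence theorem needs a closed box; the two
    domains differ only on the axes. *)
Let integral_strip (A : set R) (a b c : R) : a < b -> measurable A ->
  (forall x, x != 0 -> (A x <-> x \in `[a, b])) ->
  (forall x, A x -> x != 0) ->
  (forall x, x \in `[a, b] -> x + c != 0) ->
  (\int[leb2 R]_(p in A `*` S) (W c p)%:E =
   \int[leb2 R]_(p in `[a, b] `*` `[(- M)%R, M]) (W c p)%:E)%E.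
Proof.
move=> ab mA Aab A0 xc.
have mAS : @measurable _ (plane R) (A `*` S) by exact: measurableX.
have mbox : @measurable _ (plane R) (`[a, b] `*` `[- M, M]).
  by apply: (@measurableX _ _ (measurableTypeR R) (measurableTypeR R)); exact: measurable_itv.
apply: (@integral_eq_off_null _ (plane R) _ _ _ _ axes) => //.
- by apply/measurable_EFinP; apply: measurableW => // p [_ /S0]; exact: den_neq0.
- apply/measurable_EFinP; apply: measurableW => // p [/xc xc' _].
  by rewrite gt_eqF// ltr_wpDr ?sqr_ge0// lt_neqAle sqr_ge0 eq_sym sqrf_eq0 xc'.
- move=> p /not_axes[p1 p2]; apply: patch_iff; split=> -[u v]; split.
  + exact/Aab.
  + exact/S_iff.
  + exact/Aab.
  + exact/S_iff.
Qed.

(** The edge [x = M] contributes nothing, and the edge [x = 0] enters with a minus sign because it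
    is the left end of the box. *)
Let integral_right (c : R) : 0 < c ->
  (\int[leb2 R]_(p in `]0%R, M] `*` S) (W c p)%:E =
   \int[@lebesgue_measure R]_(y in `[(- M)%R, M])
     (- ((c * f (0, y) + y * g (0, y)) / (c ^+ 2 + y ^+ 2)))%:E)%E.
Proof.
move=> c0; rewrite (@integral_strip _ 0 M)//; last 3 first.
- by move=> x x0; rewrite /= !in_itv/= [0 <= x]le_eqVlt [0 == x]eq_sym (negbTE x0).
- by move=> x /=; rewrite in_itv/= => /andP[x0 _]; rewrite gt_eqF.
- by move=> x; rewrite in_itv/= => /andP[x0 _]; rewrite gt_eqF// ltr_wpDl.
rewrite (integral_shifted_integrand_box M0 Hf Hg)//; last first.
  by move=> x; rewrite in_itv/= => /andP[x0 _]; rewrite gt_eqF// ltr_wpDl.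
have aM : M <= `|M| by rewrite normM.
apply: eq_integral => y _; rewrite (f_out y aM) (g_out y aM).
by rewrite !mulr0 add0r mul0r sub0r add0r.
Qed.

Let integral_left (c : R) : 0 < c ->
  (\int[leb2 R]_(p in `[(- M)%R, 0%R[ `*` S) (W (- c) p)%:E =
   \int[@lebesgue_measure R]_(y in `[(- M)%R, M])
     ((- c * f (0, y) + y * g (0, y)) / (c ^+ 2 + y ^+ 2))%:E)%E.
Proof.
move=> c0.
have xc x : x \in `[- M, 0] -> x - c != 0.
  by rewrite in_itv/= => /andP[_ x0]; rewrite lt_eqF// subr_lt0 (le_lt_trans x0).
have NM0 : - M < 0 by rewrite oppr_lt0.
rewrite (@integral_strip _ (- M) 0)//; last 2 first.
- by move=> x x0; rewrite /= !in_itv/= [x <= 0]le_eqVlt (negbTE x0).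
- by move=> x /=; rewrite in_itv/= => /andP[_ x0]; rewrite lt_eqF.
rewrite (integral_shifted_integrand_box M0 Hf Hg)//.
have aM : M <= `|- M| by rewrite normrN normM.
apply: eq_integral => y _; rewrite (f_out y aM) (g_out y aM).
by rewrite !mulr0 !add0r mul0r subr0 sqrrN.
Qed.

Let cvg_boundary :
  (\int[leb2 R]_(p in `]0%R, M] `*` S) (W n.+1%:R^-1 p)%:E +
   \int[leb2 R]_(p in `[(- M)%R, 0%R[ `*` S) (W (- n.+1%:R^-1) p)%:E)%E @[n --> \oo]
  --> (- (2 * pi * f (0, 0)))%:E.
Proof.
have cf : continuous (fun y => f (0, y)).
  by move=> y; apply: (@continuous_plane_vertical _ _ (0, y)); exact: C1s_continuous Hf _.
have cg : continuous (fun y => g (0, y)).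
  by move=> y; apply: (@continuous_plane_vertical _ _ (0, y)); exact: C1s_continuous Hg _.
have cfy : continuous (fun y => fy (0, y)).
  by move=> y; apply: (@continuous_plane_vertical _ _ (0, y)); exact: C1s_cy Hf _.
have fM : f (0, M) = 0.
  by have [|-> _ _] := @C1s_out _ _ _ _ _ _ Hf (0, M) => //; right; rewrite /= normM.
have fNM : f (0, - M) = 0.
  by have [|-> _ _] := @C1s_out _ _ _ _ _ _ Hf (0, - M) => //; right; rewrite /= normrN normM.
have P := @cvg_poisson_kernel R M (fun y => f (0, y)) (fun y => fy (0, y)) M0 (fun y => C1s_dy
  Hf (0, y)) cfy fM fNM.
rewrite EFinN.
have -> : (fun n : nat => (\int[leb2 R]_(p in `]0%R, M] `*` S) (W n.+1%:R^-1 p)%:E +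
   \int[leb2 R]_(p in `[(- M)%R, 0%R[ `*` S) (W (- n.+1%:R^-1) p)%:E)%E) =
   (fun n : nat => (- \int[@lebesgue_measure R]_(y in `[(- M)%R, M])
      (2 * (n.+1%:R^-1 * f (0, y)) / (n.+1%:R^-1 ^+ 2 + y ^+ 2))%:E)%E).
  apply/funext => n; set c : R := n.+1%:R^-1.
  have c0 : 0 < c by rewrite invr_gt0 ltr0Sn.
  have d0 y : c ^+ 2 + y ^+ 2 != 0 by rewrite gt_eqF// ltr_wpDr ?sqr_ge0// exprn_gt0.
  have cd (y : R) : {for y, continuous (fun y : R => c ^+ 2 + y ^+ 2)}.
    by apply: cvgD; [exact: cvg_cst|apply: cvgM; exact: cvg_id].
  have cn k (y : R) : {for y, continuous (fun y : R => k * f (0, y) + y * g (0, y))}.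
    apply: cvgD; first by apply: cvgM; [exact: cvg_cst|exact: cf].
    by apply: cvgM; [exact: cvg_id|exact: cg].
  have cq k : continuous (fun y : R => (k * f (0, y) + y * g (0, y)) / (c ^+ 2 + y ^+ 2)).
    by move=> y; exact: (continuous_div (cn k y) (cd y) (d0 y)).
  have iI (h : R -> R) : continuous h -> (@lebesgue_measure R).-integrable `[- M, M] (EFin \o
    h).
    move=> ch; apply: continuous_compact_integrable; first exact: segment_compact.
    exact: continuous_subspaceT.
  rewrite integral_right// integral_left// -integralD//=; last 2 first.
  - by apply: iI => y; apply: cvgN; exact: cq.
  - by apply: iI; exact: cq.
  have mI : @measurable _ (measurableTypeR R) `[- M, M] by exact: measurable_itv.
  have i2 : continuous (fun y : R => 2 * (c * f (0, y)) / (c ^+ 2 + y ^+ 2)).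
    move=> y; apply: (@continuous_div R _ (fun y : R => 2 * (c * f (0, y))) (fun y : R => c ^+ 2
      + y ^+ 2) y) => //.
    by apply: cvgM; [exact: cvg_cst|apply: cvgM; [exact: cvg_cst|exact: cf]].
  rewrite -integralN; last exact: (integrable_add_def mI (iI _ i2)).
  apply: eq_integral => y _; rewrite -EFinD -EFinN; congr EFin.
  by have := d0 y => d; field.
exact: cvgeN.
Qed.

Let right_left_disjoint : [disjoint `]0, M] `*` S & `[- M, 0[ `*` S].
Proof.
apply/disj_setPS => -[x y] [[/= + _] [+ _]]; rewrite !in_itv/= => /andP[x0 _] /andP[_].
by rewrite ltNge (ltW x0).
Qed.

Lemma integral_cracktip_field :
  (leb2 R).-integrable (~` halfline R) (EFin \o W 0) /\
  (\int[leb2 R]_(p in ~` halfline R) (W 0 p)%:E = (- (2 * pi * f (0, 0)))%:E)%E.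
Proof.
have c0 : (fun n => n.+1%:R^-1 : R) @ \oo --> (0 : R) by exact: cvg_harmonic.
have c0N : (fun n => - n.+1%:R^-1 : R) @ \oo --> (0 : R) by rewrite -[X in _ --> X]oppr0;
  exact: cvgN.
have cn n : (0 : R) < n.+1%:R^-1 by rewrite invr_gt0 ltr0Sn.
have mp : @measurable _ (measurableTypeR R) `]0, M] by exact: measurable_itv.
have mn : @measurable _ (measurableTypeR R) `[- M, 0[ by exact: measurable_itv.
have hp n x : `]0, M]%classic x -> `|x| <= `|x + n.+1%:R^-1|.
  by rewrite /= in_itv/= => /andP[x0 _]; move: (n.+1%:R^-1) (cn n) => c cpos;
    rewrite (gtr0_norm x0) gtr0_norm; lra.
have hn n x : `[- M, 0[%classic x -> `|x| <= `|x + - n.+1%:R^-1|.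
  by rewrite /= in_itv/= => /andP[_ x0]; move: (n.+1%:R^-1) (cn n) => c cpos;
    rewrite (ltr0_norm x0) ltr0_norm; lra.
have [ip cp] := cvg_integral_shifted mp (@subsetUr _ _ _) c0 hp.
have [iN cN] := cvg_integral_shifted mn (@subsetUl _ _ _) c0N hn.
have mpS : @measurable _ (plane R) (`]0, M] `*` S) by exact: measurableX.
have mnS : @measurable _ (plane R) (`[- M, 0[ `*` S) by exact: measurableX.
have mSS : @measurable _ (plane R) (S `*` S) by exact: measurableX.
have SE : S `*` S = `]0, M] `*` S `|` `[- M, 0[ `*` S.
  apply/seteqP; split=> -[x y] /=; rewrite /S /=.
    by move=> [[a|a] b]; [right|left].
  by move=> [[a b]|[a b]]; split => //; [right|left].
have mW : measurable_fun (S `*` S) (W 0).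
  by apply: measurableW => // p [_ /S0]; exact: den_neq0.
have iSS : (leb2 R).-integrable (S `*` S) (EFin \o W 0).
  apply/integrableP; split; first exact/measurable_EFinP.
  rewrite SE ge0_integral_setU//.
  - by apply: lte_add_pinfty; [have /integrableP[] := ip|have /integrableP[] := iN].
  - by rewrite -SE; apply: measurableT_comp => //; exact/measurable_EFinP.
have IE : (\int[leb2 R]_(p in S `*` S) (W 0 p)%:E = (- (2 * pi * f (0, 0)))%:E)%E.
  rewrite SE integral_setU//; last by rewrite -SE; exact/measurable_EFinP.
  have fp := integrable_fin_num mpS ip; have fN := integrable_fin_num mnS iN.
  (* The two halves converge separately to the integrals of [W 0], so by uniqueness of limits the
     sum of these is the limit in [cvg_boundary]. Finiteness makes the extended sum well defined. *)
  have H := cvgeD (fin_num_adde_defr _ fp) cp cN.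
  exact: (etrans (esym (cvg_lim (@ereal_hausdorff R) (H _))) (cvg_lim (@ereal_hausdorff R)
    cvg_boundary)).
have mK : @measurable _ (plane R) (~` halfline R).
  apply: measurableC; apply: (@measurableX _ _ (measurableTypeR R) (measurableTypeR R)).
    exact: measurable_itv.
  exact: (@measurable_set1 R).
have mWK : measurable_fun (~` halfline R) (W 0).
  (* The denominator vanishes only at the origin, which belongs to the half-line. *)
  apply: measurableW => // -[x y] /= K; rewrite addr0; apply/eqP => /eqP.
  rewrite paddr_eq0 ?sqr_ge0// !sqrf_eq0 => /andP[/eqP x0 /eqP y0].
  by apply: K; split => /=; rewrite ?x0 ?y0// in_itv/= lexx.
(* Off the axes, a point outside [S * S] has a coordinate of modulus at least [M], where all partial
   derivatives vanish and so does the integrand. *)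
have KE p : ~ axes p -> ((EFin \o W 0) \_ (~` halfline R)) p = ((EFin \o W 0) \_ (S `*` S)) p.
  move=> /not_axes[p1 p2].
  have [pS|pS] := pselect ((S `*` S) p).
    by apply: patch_iff; split => // _ [_ /= p20]; rewrite p20 eqxx in p2.
  rewrite [RHS]patchE ifN ?notin_setE// patchE; case: ifP => // _.
  rewrite /= /shifted_integrand.
  have pM : M <= `|p.1| \/ M <= `|p.2|.
    have [//|h1] := leP M `|p.1|; first by left.
    have [//|h2] := leP M `|p.2|; first by right.
    exfalso; apply: pS; split; apply/S_iff => //; rewrite in_itv/= -ler_norml; exact: ltW.
  have [_ -> ->] := C1s_out Hf pM; have [_ -> ->] := C1s_out Hg pM.
  by rewrite !mulr0 !addr0 subrr mul0r.
split.
  by apply: (@integrable_eq_off_null _ (plane R) _ _ _ (S `*` S) axes) => //;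
    exact/measurable_EFinP.
rewrite -IE; apply: (@integral_eq_off_null _ (plane R) _ _ _ _ axes) => //;
  exact/measurable_EFinP.
Qed.

End cracktip_field.

(** * The gradient of the cracktip *)

Section cracktip_gradient.
Context {R : realType}.

Definition radius (p : R * R) : R := Num.sqrt (p.1 ^+ 2 + p.2 ^+ 2).

(** For angles in []-pi, pi[] the half-angle formula gives
    [sin (theta / 2) = y / sqrt (2 r (r + x))]; the factor [sqrt (2 r)] then cancels. *)
Definition cracktip (p : R * R) : R := p.2 / Num.sqrt (pi * (radius p + p.1)).

Lemma radius_sqr p : radius p ^+ 2 = p.1 ^+ 2 + p.2 ^+ 2.
Proof. by rewrite sqr_sqrtr// addr_ge0// sqr_ge0. Qed.

(** If [r + x <= 0], then [0 <= r <= - x], so [r ^ 2 <= x ^ 2], which forces [y = 0] and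
    [x <= 0]. *)
Lemma off_halfline p : ~ halfline R p -> 0 < radius p + p.1.
Proof.
move=> pK; rewrite ltNge; apply/negP => u0; apply: pK.
have r0 : 0 <= radius p by exact: sqrtr_ge0.
have rE := radius_sqr p.
have y0 : p.2 ^+ 2 <= 0 by nra.
split; first by rewrite /= in_itv/=; lra.
by apply/eqP; rewrite -sqrf_eq0 eq_le y0 sqr_ge0.
Qed.

Lemma radius_gt0 p : ~ halfline R p -> 0 < radius p.
Proof.
move=> /off_halfline u0; rewrite lt_neqAle sqrtr_ge0 andbT eq_sym; apply/eqP => r0.
have := radius_sqr p; move: u0; rewrite r0; nra.
Qed.

(* With [t = y / (r + x)], the polar angle is [2 atan t]. *)
Lemma cracktipE (phi : R * R -> R) p : is_cracktip_function phi ->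
  ~ halfline R p -> phi p = cracktip p.
Proof.
case: p => x y hphi pK; have u0 := off_halfline pK; have r0 := radius_gt0 pK.
have rE := radius_sqr (x, y); rewrite /cracktip; set r := radius (x, y) in u0 r0 rE *;
  rewrite /= in u0 rE *.
set u := r + x in u0 *; pose t := y / u; pose th := 2 * atan t.
have u0' := lt0r_neq0 u0; have r0' := lt0r_neq0 r0.
(* This rests on [y ^ 2 = (r - x) (r + x)]. *)
have qE : 1 + t ^+ 2 = 2 * r / u.
  rewrite /t; have : y ^+ 2 = (r - x) * u by rewrite /u; lra.
  by rewrite expr_div_n => ->; rewrite /u; field.
have q0 : 0 < 1 + t ^+ 2 by rewrite qE divr_gt0// mulr_gt0.
have sq0 : 0 < Num.sqrt (1 + t ^+ 2) by rewrite sqrtr_gt0.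
have cosE : cos (atan t) ^+ 2 = (1 + t ^+ 2)^-1 by rewrite cos_atan exprVn sqr_sqrtr// ltW.
have c0 : cos (atan t) != 0 by rewrite cos_atan invr_neq0// gt_eqF.
have sinE : sin (atan t) = t * cos (atan t) by rewrite -{2}(atanK t) /tan divfK.
have ex : x = r * cos th.
  by rewrite /th mulr_natl cos_mulr2n -mulr_natl cosE qE /u; field; rewrite ?r0' ?u0'.
have ey : y = r * sin th.
  rewrite /th mulr_natl sin_mulr2n sinE (_ : _ *+ 2 = 2 * (t * cos (atan t) ^+ 2));
    last by rewrite -mulr_natl; ring.
  by rewrite cosE qE /t /u; field; rewrite ?r0' ?u0'.
have thE : th / 2 = atan t by rewrite /th; field.
(* The values of [phi] are prescribed only in polar form. The angle [2 atan t] is admissible because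
   [atan] takes values in []- pi / 2, pi / 2[]. *)
rewrite {1}ex {1}ey hphi//; last first.
  by have := atan_gtNpi2 t; have := atan_ltpi2 t; rewrite /th => h1 h2; apply/andP; split; lra.
rewrite thE sinE cos_atan qE.
have p0 : 0 < pi :> R by exact: pi_gt0.
rewrite !sqrtrM ?mulr_ge0 ?ltW// !sqrtrV ?ltW// /t.
have su0 : Num.sqrt u != 0 by rewrite gt_eqF// sqrtr_gt0.
have sr0 : Num.sqrt r != 0 by rewrite gt_eqF// sqrtr_gt0.
have sp0 : Num.sqrt pi != 0 :> R by rewrite gt_eqF// sqrtr_gt0.
have s20 : Num.sqrt 2 != 0 :> R by rewrite gt_eqF// sqrtr_gt0.
have uE : u = Num.sqrt u ^+ 2 by rewrite sqr_sqrtr// ltW.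
by rewrite [in y / u]uE; field; rewrite ?su0 ?sr0 ?sp0 ?s20.
Qed.

Lemma is_derive_radius_x p : ~ halfline R p ->
  is_derive p.1 (1 : R) (fun s => radius (s, p.2)) (p.1 / radius p).
Proof.
case: p => x y pK; have r0 := radius_gt0 pK; have := r0; rewrite {1}/radius sqrtr_gt0 /= => d0.
have d1 := is_derive_sqr_shift 0 (y ^+ 2) x.
have E : (fun s : R => (s + 0) ^+ 2 + y ^+ 2) = (fun s => s ^+ 2 + y ^+ 2).
  by apply/funext => s; rewrite addr0.
rewrite E in d1.
have d2 := @is_derive1_comp R Num.sqrt (fun s : R => s ^+ 2 + y ^+ 2) x _ _ (is_derive1_sqrt d0)
  d1.
refine (@is_derive_eq _ _ _ _ _ _ _ _ d2 _).
by rewrite addr0 -/(radius (x, y)); have := lt0r_neq0 r0 => r0'; field.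
Qed.

Lemma is_derive_radius_y p : ~ halfline R p ->
  is_derive p.2 (1 : R) (fun s => radius (p.1, s)) (p.2 / radius p).
Proof.
case: p => x y pK; have r0 := radius_gt0 pK; have := r0; rewrite {1}/radius sqrtr_gt0 /= => d0.
have d1 := is_derive_sqr_shift 0 (x ^+ 2) y.
have E : (fun s : R => (s + 0) ^+ 2 + x ^+ 2) = (fun s => x ^+ 2 + s ^+ 2).
  by apply/funext => s; rewrite addr0 addrC.
rewrite E in d1.
have d2 := @is_derive1_comp R Num.sqrt (fun s : R => x ^+ 2 + s ^+ 2) y _ _ (is_derive1_sqrt d0)
  d1.
refine (@is_derive_eq _ _ _ _ _ _ _ _ d2 _).
by rewrite addr0 -/(radius (x, y)); have := lt0r_neq0 r0 => r0'; field.
Qed.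

Lemma is_derive_div_sqrt (n u : R -> R) (x n' u' : R) : 0 < u x ->
  is_derive x (1 : R) n n' -> is_derive x (1 : R) u u' ->
  is_derive x (1 : R) (fun s => n s / Num.sqrt (pi * u s))
    ((2 * u x * n' - n x * u') / (2 * u x * Num.sqrt (pi * u x))).
Proof.
move=> u0 dn du.
have pu : 0 < pi * u x by rewrite mulr_gt0// pi_gt0.
have d1 : is_derive x (1 : R) (fun s => pi * u s) (pi * u').
  by apply: is_derive_eq; rewrite /GRing.scale/=; ring.
have d2 := @is_derive1_comp R Num.sqrt (fun s : R => pi * u s) x _ _ (is_derive1_sqrt pu) d1.
have s0 : Num.sqrt (pi * u x) != 0 by rewrite gt_eqF// sqrtr_gt0.
have d3 := is_derive_div dn d2 s0.
refine (@is_derive_eq _ _ _ _ _ _ _ _ d3 _).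
have sE : Num.sqrt (pi * u x) ^+ 2 = pi * u x by rewrite sqr_sqrtr// ltW.
have u0' := lt0r_neq0 u0; have p0' : pi != 0 :> R by rewrite gt_eqF// pi_gt0.
rewrite /= sE.
transitivity ((2 * Num.sqrt (pi * u x) ^+ 2 * n' - n x * (pi * u')) /
  (2 * Num.sqrt (pi * u x) * (pi * u x))).
  by move: s0 p0'; move: (pi : R) => P s0 p0'; field; rewrite s0 u0' p0'.
by rewrite sE; move: s0 p0'; move: (pi : R) => P s0 p0'; field; rewrite s0 u0' p0'.
Qed.

Lemma closed_halfline : closed (halfline R).
Proof.
have -> : halfline R = (fst @^-1` `]-oo, 0%R]%classic) `&` (snd @^-1` [set 0%R]).
  by apply/seteqP; split => -[x y].
apply: closedI; apply: (closed_comp (T := (R * R)%type)).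
- by move=> p _; exact: cvg_fst.
- exact: interval_closed.
- by move=> p _; exact: cvg_snd.
- exact: closed_eq.
Qed.

Variable phi : R * R -> R.
Hypothesis hphi : is_cracktip_function phi.

(** The half-line is closed, so the explicit formula holds in a neighbourhood of each point off it,
    and derivatives can be computed from the formula. *)
Let near_phi p : ~ halfline R p -> \forall q \near p, phi q = cracktip q.
Proof.
move=> pK; have oK : open (~` halfline R) by apply: closed_openC; exact: closed_halfline.
have nb : nbhs p (~` halfline R) by apply: open_nbhs_nbhs.
by near=> q; apply: cracktipE => //; near: q.
Unshelve. all: by end_near. Qed.

Lemma partial_cracktip p : ~ halfline R p ->
  partial ord0 phi p = - p.2 / (2 * radius p * Num.sqrt (pi * (radius p + p.1))) /\
  partial ord_max phi p = (radius p + p.1) / (2 * radius p * Num.sqrt (pi * (radius p + p.1))).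
Proof.
move=> pK; rewrite /partial !(near_eq_derive _ (near_phi pK)).
have u0 := off_halfline pK; have r0 := radius_gt0 pK.
have u0' := lt0r_neq0 u0; have r0' := lt0r_neq0 r0.
have s0 : Num.sqrt (pi * (radius p + p.1)) != 0 by rewrite gt_eqF// sqrtr_gt0 mulr_gt0// pi_gt0.
split.
- have d : is_derive p.1 (1 : R) (fun s => cracktip (s, p.2))
      (- p.2 / (2 * radius p * Num.sqrt (pi * (radius p + p.1)))).
    have dr := is_derive_radius_x pK.
    have d1 : is_derive p.1 (1 : R) (fun s => radius (s, p.2) + s) (p.1 / radius p + 1).
      by apply: is_derive_eq.
    case: p pK u0 r0 u0' r0' s0 dr d1 => x y pK u0 r0 u0' r0' s0 dr d1.
    refine (@is_derive_eq _ _ _ _ _ _ _ _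
      (@is_derive_div_sqrt (fun=> y) (fun s => radius (s, y) + s) x _ _ u0 (is_derive_cst y x 1)
        d1) _).
    by rewrite /=; field; rewrite ?r0' ?s0 ?u0'.
  by have [] := (is_derive_horizontal cracktip p _).2 d.
- have d : is_derive p.2 (1 : R) (fun s => cracktip (p.1, s))
      ((radius p + p.1) / (2 * radius p * Num.sqrt (pi * (radius p + p.1)))).
    have dr := is_derive_radius_y pK.
    have d1 : is_derive p.2 (1 : R) (fun s => radius (p.1, s) + p.1) (p.2 / radius p).
      by apply: is_derive_eq; rewrite addr0.
    have rE := radius_sqr p.
    case: p pK u0 r0 u0' r0' s0 dr d1 rE => x y pK u0 r0 u0' r0' s0 dr d1 /= rE.
    refine (@is_derive_eq _ _ _ _ _ _ _ _
      (@is_derive_div_sqrt id (fun s => radius (x, s) + x) y _ _ u0 (is_derive_id y 1) d1) _).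
    rewrite /=; set r := radius (x, y) in u0' r0' s0 rE *; set w := Num.sqrt _ in s0 *.
    (* Eliminating [y ^ 2] lets the factor [r + x] cancel from the quotient. *)
    have y2 : y ^+ 2 = r ^+ 2 - x ^+ 2 by rewrite rE; ring.
    transitivity ((2 * (r + x) * r - y ^+ 2) / (2 * (r + x) * r * w)).
      by field; rewrite ?r0' ?s0 ?u0'.
    by rewrite y2; field; rewrite ?r0' ?s0 ?u0'.
  by have [] := (is_derive_vertical cracktip p _).2 d.
Qed.

Lemma sum_ord2 (F : 'I_2 -> R) : \sum_(i < 2) F i = F ord0 + F ord_max.
Proof.
by rewrite !big_ord_recl big_ord0 addr0; congr (_ + F _); exact: val_inj.
Qed.

(** Expanding, the integrand is [(phi_y ^ 2 - phi_x ^ 2) (f_x - g_y) - 2 phi_x phi_y (f_y + g_x)].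
    The two coefficients are [x / (2 pi r ^ 2)] and [y / (2 pi r ^ 2)]. *)
Lemma energy_integrandE (eta : R * R -> R * R) p : ~ halfline R p ->
  grad_sqnorm phi p * div eta p - 2 * grad_form phi eta p =
  (2 * pi)^-1 * shifted_integrand 0
    (partial ord0 (fun q => Defs.coord ord0 (eta q))) (partial ord_max (fun q => Defs.coord ord0
      (eta q)))
    (partial ord0 (fun q => Defs.coord ord_max (eta q))) (partial ord_max (fun q => Defs.coord
      ord_max (eta q))) p.
Proof.
move=> pK; rewrite /grad_sqnorm /grad_form /div !sum_ord2 /shifted_integrand.
have [-> ->] := partial_cracktip pK.
set fx := partial ord0 (fun q => Defs.coord ord0 _) p;
  set fy := partial ord_max (fun q => Defs.coord ord0 _) p.
set gx := partial ord0 (fun q => Defs.coord ord_max _) p;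
  set gy := partial ord_max (fun q => Defs.coord ord_max _) p.
have u0 := off_halfline pK; have r0 := radius_gt0 pK; have rE := radius_sqr p.
have u0' := lt0r_neq0 u0; have r0' := lt0r_neq0 r0.
rewrite addr0 -rE; set w := Num.sqrt _.
have w0 : w != 0 by rewrite gt_eqF// sqrtr_gt0 mulr_gt0// pi_gt0.
have wE : w ^+ 2 = pi * (radius p + p.1) by rewrite sqr_sqrtr// mulr_ge0 ?pi_ge0// ltW.
have p0' : pi != 0 :> R by rewrite gt_eqF// pi_gt0.
set r := radius p in u0' r0' rE wE *.
transitivity (((r + p.1) ^+ 2 - p.2 ^+ 2) / (4 * r ^+ 2 * w ^+ 2) * (fx - gy) +
   2 * p.2 * (r + p.1) / (4 * r ^+ 2 * w ^+ 2) * (fy + gx)).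
  by field; rewrite ?r0' ?w0.
have -> : (r + p.1) ^+ 2 - p.2 ^+ 2 = 2 * p.1 * (r + p.1).
  have -> : p.2 ^+ 2 = r ^+ 2 - p.1 ^+ 2 by rewrite rE; ring.
  by ring.
by rewrite wE; move: p0'; move: (pi : R) => P p0'; field; rewrite r0' u0' p0'.
Qed.

End cracktip_gradient.

(** * Hausdorff measure on the half-line *)

Section integral_agree_on.
Import HBNNSimple.

(* [hausdorff1] is a bare set function, to which the lemmas on integrals against a
   measure do not apply. *)
Lemma integral_agree_on d (T : measurableType d) (R : realType) (mu nu : set T -> \bar R)
    (D : set T) (f : T -> \bar R) :
  (forall A, measurable A -> A `<=` D -> mu A = nu A) ->
  (\int[mu]_(x in D) f x = \int[nu]_(x in D) f x)%E.
Proof.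
move=> munu.
have S (g : T -> \bar R) : (forall x, ~ D x -> g x = 0%E) ->
    [set sintegral mu h | h in [set h : {nnsfun T >-> R} | forall x, ((h x)%:E <= g x)%E]] =
    [set sintegral nu h | h in [set h : {nnsfun T >-> R} | forall x, ((h x)%:E <= g x)%E]].
  move=> gD; have E (h : {nnsfun T >-> R}) : (forall x, ((h x)%:E <= g x)%E) ->
      sintegral mu h = sintegral nu h.
    (* A nonnegative simple function below [g] vanishes off [D], so its level sets at nonzero values
       lie in [D], where the two set functions agree. The value 0 has weight 0. *)
    move=> hg; apply: eq_fsbigr => r _; have [->|r0] := eqVneq r 0; first by rewrite !mul0e.
    congr (_ * _)%E; apply: munu; first exact: measurable_sfunP.
    move=> x hx; apply: contrapT => Dx; move: (hg x); rewrite (gD _ Dx) lee_fin hx => r1.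
    by move: r0; rewrite eq_le r1 -hx fun_ge0.
  by apply/seteqP; split=> _ [h hg <-]; exists h => //; rewrite E.
rewrite /integral; congr (ereal_sup _ - ereal_sup _)%E; apply: S => x Dx.
- by rewrite funeposE patchE memNset// maxxx.
- by rewrite funenegE patchE memNset// oppe0 maxxx.
Qed.

End integral_agree_on.

Section hausdorff_halfline.
Context {R : realType}.
Notation leb := (@lebesgue_measure R).
Local Notation inc := (fun x : R => (x, 0) : R * R).

Lemma euclid_dist_axis (x y : R) : euclid_dist (inc x) (inc y) = `|x - y|.
Proof. by rewrite /euclid_dist /= subrr expr0n addr0 sqrtr_sqr. Qed.

Lemma diam_ge0 (C : set (R * R)) : (0 <= diam C)%E.
Proof. by apply: ereal_sup_ubound; left. Qed.

Lemma diam_ge (C : set (R * R)) p q : C p -> C q -> ((euclid_dist p q)%:E <= diam C)%E.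
Proof. by move=> Cp Cq; apply: ereal_sup_ubound; right; exists p => //; exists q. Qed.

Lemma diam_interval (B : set R) (u v : R) : B `<=` `]u, v] ->
  (diam (inc @` B) <= leb `]u, v]%classic)%E.
Proof.
move=> Buv; apply: ge_ereal_sup => z [->|]; first exact: measure_ge0.
move=> [_ [x Bx <-] [_ [y By <-] <-]]; rewrite euclid_dist_axis.
have := Buv _ Bx; have := Buv _ By; rewrite /= !in_itv/= => /andP[uy yv] /andP[ux xv].
rewrite lebesgue_measure_itv/= lte_fin (lt_le_trans ux xv) -EFinB lee_fin ler_norml.
by apply/andP; split; lra.
Qed.

(** The sets of a Hausdorff cover need not be measurable. The trace on the axis is enclosed in the
    segment from its infimum to its supremum, or in the whole line when the diameter is infinite. *)
Lemma section_hull (C : set (R * R)) :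
  exists I : set R, [/\ measurable I, inc @^-1` C `<=` I & (leb I <= diam C)%E].
Proof.
set B := inc @^-1` C.
have [B0|/set0P B0] := eqVneq B set0.
  by exists set0; rewrite B0 measure0; split => //; exact: diam_ge0.
have := diam_ge0 C; case dE : (diam C) => [r| |] // r0; last first.
  by exists setT; split => //; rewrite leey.
have Br x y : B x -> B y -> x - y <= r.
  move=> Bx By; have := diam_ge Bx By; rewrite dE lee_fin euclid_dist_axis.
  exact: le_trans (ler_norm _).
have [b Bb] := B0.
have ubB : has_ubound B by exists (b + r) => x Bx; rewrite -lerBlDl; exact: Br.
have lbB : has_lbound B by exists (b - r) => x Bx; rewrite lerBlDr -lerBlDl; exact: Br.
exists `[inf B, sup B]%classic; split.
- exact: measurable_itv.
- by move=> x Bx; rewrite /= in_itv/= (ge_inf lbB Bx) (ub_le_sup ubB Bx).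
- rewrite lebesgue_measure_itv/= lte_fin; case: ifP => // _; rewrite -EFinB lee_fin.
  rewrite lerBlDr; apply: ge_sup => // x Bx; rewrite -lerBlDl; apply: lb_le_inf => // y By.
  by rewrite lerBlDr -lerBlDl; exact: Br.
Qed.

Variable A : set (R * R).
Hypotheses (mA : measurable A) (AK : A `<=` halfline R).
Let B : set R := inc @^-1` A.

Let mB : @measurable _ (measurableTypeR R) B.
Proof.
have minc : measurable_fun setT inc by apply: measurable_fun_pair.
by rewrite -[B]setTI; exact: minc.
Qed.

(** The hulls of the traces of any cover still cover [B], so countable subadditivity suffices. The
    size restriction is not exploited, hence the choice [delta = 1]. *)
Let hausdorff1_ge : (leb B <= hausdorff1 A)%E.
Proof.
apply: (@le_trans _ _ (hausdorff1_delta 1 A)); last first.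
  by apply: ereal_sup_ubound; exists 1 => //=.
apply: le_ereal_inf_tmp => _ [C [AC _] <-].
have /choice[I IP] := fun k => section_hull (C k).
apply: (@le_trans _ _ (\sum_(0 <= k <oo) leb (I k))%E).
  apply: measure_sigma_subadditive => //.
    by move=> n; have [] := IP n.
  by move=> x /AC [k _ Ck]; exists k => //; have [_ + _] := IP k; apply.
by apply: lee_nneseries => // k _; have [] := IP k.
Qed.

(* A countable cover by half-open intervals is cut along a grid of mesh delta, so
   that the pieces have diameter at most delta. *)
Let hausdorff1_delta_le (delta : R) : 0 < delta -> (hausdorff1_delta delta A <= leb B)%E.
Proof.
move=> d0.
(* Unfolding exposes Lebesgue measure as an infimum over countable covers by half-open intervals. *)
rewrite /lebesgue_measure /lebesgue_stieltjes_measure /measure_extension/=.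
apply: le_ereal_inf_tmp => _ [F [mF BF] <-].
(* The cells tile []-oo, 0]] only, which suffices because [A] lies in the half-line. *)
pose G (n : nat) : set R := `]- (n.+1%:R * delta), - (n%:R * delta)]%classic.
(* The pieces are indexed by pairs (interval, cell); a bijection with the natural numbers turns them
   into a sequence. *)
have /card_esym/ppcard_eqP[e] := card_nat2.
pose D (ij : nat * nat) : set R := F ij.1 `&` G ij.2.
have DE ij : exists u v, [/\ D ij = `]u, v]%classic & D ij `<=` G ij.2].
  have [[a b] _ FE] := mF ij.1.
  exists (Num.max a (- (ij.2.+1%:R * delta))), (Num.min b (- (ij.2%:R * delta))).
  split; last exact: subIsetr.
  apply/seteqP; split => x; rewrite /D -FE /G /= !in_itv/= gt_max le_min.
    by move=> [/andP[-> ->] /andP[-> ->]].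
  by move=> /andP[/andP[-> ->] /andP[-> ->]].
have mD ij : @measurable _ (measurableTypeR R) (D ij).
  by have [u [v [-> _]]] := DE ij; exact: measurable_itv.
apply: (@le_trans _ _ (\sum_(0 <= m <oo) diam (inc @` D (e m)))%E).
  apply: ereal_inf_lbound; exists (fun m => inc @` D (e m)) => //; split.
    move=> [x y] Axy; have [/= x0 y0] := AK Axy; rewrite in_itv/= in x0.
    rewrite y0 in Axy *; have [k _ Fk] := BF _ Axy.
    (* This is the cell containing [x]: [n delta <= - x < (n + 1) delta]. *)
    pose n := Num.truncn (- x / delta).
    exists (e^-1%FUN (k, n)) => //; exists x => //; rewrite invK ?inE//; split => //=.
    have xd0 : 0 <= - x / delta by rewrite divr_ge0 ?oppr_ge0// ltW.
    have := truncn_itv xd0; rewrite -/n => /andP[n1 n2].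
    by rewrite /G /= in_itv/= ltrNl lerNr -ltr_pdivrMr// n2 -ler_pdivlMr.
  move=> m; have [_ [_ [_ DG]]] := DE (e m); apply: le_trans (diam_interval DG) _.
  rewrite lebesgue_measure_itv/= lte_fin ltrN2 ltr_pM2r// ltr_nat ltnSn -EFinB lee_fin -natr1;
    lra.
apply: (@le_trans _ _ (\sum_(0 <= m <oo) leb (D (e m)))%E).
  apply: lee_nneseries => [m _ _|m _]; first exact: diam_ge0.
  have [u [v [E _]]] := DE (e m); rewrite E; apply: diam_interval => //.
rewrite nneseries_esumT// -(@reindex_esum R _ _ setT setT e (fun ij => leb (D ij)));
  last exact: bij.
have -> : \esum_(ij in setT) leb (D ij) =
    \esum_(i in setT) \esum_(j in setT) leb (D (i, j)).
  rewrite (@esum_esum _ _ _ setT (fun=> setT) (fun i j => leb (D (i, j))))//.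
  rewrite (_ : _ `*`` _ = setT); last by apply/seteqP; split.
  by apply: eq_esum => -[].
rewrite [leRHS]nneseries_esumT//.
apply: le_esum => k _; rewrite -nneseries_esumT//.
(* The cells are disjoint, so the lengths of the pieces of [F k] add up to at most the length of
   [F k]. *)
have tD : trivIset setT (fun j => D (k, j)).
  apply: ltn_trivIset => j i ij; rewrite /D /=; apply/seteqP; split => // x [[_ xi] [_ xj]].
  have : (i.+1%:R * delta <= j%:R * delta) by rewrite ler_pM2r// ler_nat.
  move: xi xj; rewrite /G /= !in_itv/= => /andP[xi _] /andP[_ xj].
  by rewrite -lerN2 => /(le_trans xj); rewrite leNgt xi.
rewrite -measure_semi_bigcup//; last exact: bigcupT_measurable.
have [[a b] _ FE] := mF k.
have -> : wlength idfun (F k) = leb (F k).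
  by rewrite -FE wlength_itv lebesgue_measure_itv.
apply: le_measure; rewrite ?inE.
- exact: bigcupT_measurable.
- by rewrite -FE; exact: measurable_itv.
- by move=> x [j _ []].
Qed.

Lemma hausdorff1_halfline : hausdorff1 A = leb B.
Proof.
apply/eqP; rewrite eq_le hausdorff1_ge andbT; apply: ge_ereal_sup => _ [d d0 <-].
exact: hausdorff1_delta_le.
Qed.

End hausdorff_halfline.

(** * Stationarity *)

Lemma measurable_inc_axis {R : realType} : measurable_fun setT (fun x : R => (x, 0 : R)).
Proof. exact: measurable_fun_pair. Qed.

(** On measurable subsets of the half-line the Hausdorff measure is the image of Lebesgue measure
    under [x |-> (x, 0)], a genuine measure, for which the change of variables is available. *)
Lemma integral_hausdorff1_halfline {R : realType} (h : R * R -> \bar R) :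
  measurable_fun setT h ->
  (@lebesgue_measure R).-integrable `]-oo, 0] (fun x => h (x, 0)) ->
  (\int[@hausdorff1 R]_(p in halfline R) h p =
   \int[@lebesgue_measure R]_(x in `]-oo, 0%R]) h (x, 0%R))%E.
Proof.
move=> mh ih.
rewrite (@integral_agree_on _ _ _ _ (pushforward (@lebesgue_measure R) (fun x : R => (x, 0 :
  R)))); last first.
  by move=> A mA AK; rewrite hausdorff1_halfline.
have preE : (fun x : R => (x, 0 : R)) @^-1` halfline R = `]-oo, 0]%classic.
  apply/seteqP; split => x /=; first by case.
  by move=> x0; split.
rewrite (@integral_pushforward _ _ (measurableTypeR R) _ R _ measurable_inc_axis).
- by rewrite preE.
- exact: mh.
- by rewrite preE.
- by apply: measurableX.
Qed.

(** The derivative vanishes to the left of [- M], so the integral reduces to the segment from [- M]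
    to 0. *)
Lemma integral_derive_halfline {R : realType} (M : R) (u u' : R -> R) : 0 < M ->
  (forall x, is_derive x (1 : R) u (u' x)) -> continuous u' ->
  (forall x, M <= `|x| -> u x = 0) -> (forall x, M <= `|x| -> u' x = 0) ->
  (@lebesgue_measure R).-integrable `]-oo, 0] (EFin \o u') /\
  (\int[@lebesgue_measure R]_(x in `]-oo, 0%R]) (u' x)%:E = (u 0%R)%:E)%E.
Proof.
move=> M0 du cu' u0 u'0.
have m1 : @measurable _ (measurableTypeR R) `]-oo, 0] by exact: measurable_itv.
have m2 : @measurable _ (measurableTypeR R) `[- M, 0] by exact: measurable_itv.
have E : (EFin \o u') \_ `]-oo, 0] = (EFin \o u') \_ `[- M, 0].
  apply/funext => x; rewrite !patchE !mem_setE !in_itv/=; case: (leP x 0) => [x0|];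
    last by rewrite andbF.
  rewrite andbT; case: ifPn => //; rewrite -ltNge => xM; rewrite /= u'0//.
  by rewrite ler0_norm// lerNr ltW.
have i2 : (@lebesgue_measure R).-integrable `[- M, 0] (EFin \o u').
  by apply: continuous_compact_integrable; [exact: segment_compact|exact: continuous_subspaceT].
split.
  by apply/(integrable_mkcond _ m1); rewrite E; apply/(integrable_mkcond _ m2).
have NM : - M < 0 by rewrite oppr_lt0.
have normM : M <= `|- M| by rewrite normrN ler_norm.
rewrite integral_mkcond E -integral_mkcond /= (integral_is_derive NM (fun x _ => du x) (fun x _
  => cu' x)).
by rewrite (u0 _ normM) subr0.
Qed.

Theorem proposition2p1 (R : realType) (phi0 : R * R -> R)
    (hphi0 : is_cracktip_function phi0) :
  stationary phi0 (halfline R) (fun _ => (1, 0)).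
Proof.
move=> eta Ceta; rewrite /C1c_field in Ceta.
pose f q := Defs.coord ord0 (eta q); pose g q := Defs.coord ord_max (eta q).
have [Mf [Cf Hf]] := C1c_supported (Ceta ord0 : C1c f).
have [Mg [Cg Hg]] := C1c_supported (Ceta ord_max : C1c g).
(* One square and one bound serve both components; the 1 ensures that [M] is positive. *)
pose M := Num.max 1 (Num.max Mf Mg); pose C := Num.max Cf Cg.
have M0 : 0 < M by rewrite lt_max ltr01.
have {}Hf : C1_supported M C f (partial ord0 f) (partial ord_max f).
  by apply: C1s_weaken Hf; rewrite !le_max lexx ?orbT.
have {}Hg : C1_supported M C g (partial ord0 g) (partial ord_max g).
  by apply: C1s_weaken Hg; rewrite !le_max lexx ?orbT.
have [iW WE] := integral_cracktip_field M0 Hf Hg.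
have [iu uE] : (@lebesgue_measure R).-integrable `]-oo, 0] (EFin \o (fun x => partial ord0 f (x,
  0))) /\
    (\int[@lebesgue_measure R]_(x in `]-oo, 0%R]) (partial ord0 f (x, 0%R))%:E = (f (0%R,
      0%R))%:E)%E.
  apply: (@integral_derive_halfline R M (fun x => f (x, 0))) => //.
  - by move=> x; exact: (C1s_dx Hf (x, 0)).
  - by move=> x; apply: (@continuous_plane_horizontal _ _ (x, 0)); exact: (C1s_cx Hf).
  - by move=> x Mx; have [|->] := @C1s_out _ _ _ _ _ _ Hf (x, 0) => //; left.
  - by move=> x Mx; have [|_ ->] := @C1s_out _ _ _ _ _ _ Hf (x, 0) => //; left.
have -> : (\int[@hausdorff1 R]_(p in halfline R) (tangential_div (1%R, 0%R) eta p)%:E = (f (0%R,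
  0%R))%:E)%E.
  (* With the horizontal tangent only the term [i = j = 0] of the double sum survives. *)
  have tE : tangential_div (1, 0) eta = partial ord0 f.
    by apply/funext => p; rewrite /tangential_div !sum_ord2 /Defs.coord /= !(mulr0, mul0r,
      mul1r, addr0).
  rewrite tE integral_hausdorff1_halfline//.
  apply/measurable_EFinP; apply: measurable_fun_continuous_at => // p _.
  exact: (C1s_cx Hf).
have -> : (\int[@lebesgue_measure R \x @lebesgue_measure R]_(p in ~` halfline R)
    (grad_sqnorm phi0 p * div eta p - 2 * grad_form phi0 eta p)%:E = (- f (0%R, 0%R))%:E)%E.
  transitivity (\int[@lebesgue_measure R \x @lebesgue_measure R]_(p in ~` halfline R)
    (((2 * pi)^-1)%:E * (shifted_integrand 0 (partial ord0 f) (partial ord_max f)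
      (partial ord0 g) (partial ord_max g) p)%:E))%E.
    by apply: eq_integral => p; rewrite inE => pK; rewrite (energy_integrandE hphi0).
  rewrite integralZl//; last first.
    by apply: measurableC; apply: measurableX.
  rewrite WE -EFinM; congr EFin; have p0 : pi != 0 :> R by rewrite gt_eqF// pi_gt0.
  by move: p0; move: (pi : R) => P p0; field.
by rewrite -EFinD addNr.
Qed.
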